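(* Let $X$ be a GCBA space, let $k\ge1$ be a natural number and let $F:V\to\mathbb R^k$ be a $(k,\delta)$-strainer map on an open subset $V$ of a tiny ball $U$ of $X$, with $0<\delta\le\frac1{20\cdot k}$. Then the map $F$ is open, and for any compact subset $V'$ of $V$ there is some $\epsilon>0$ with the following property: for any $x\in V'$ and any $0<r<\epsilon$, the open ball of radius $r$ around $x$ in the fiber $F^{-1}(F(x))$ is contractible.
   Context: A geodesic in a metric space is an isometric embedding of an interval; a local geodesic is a curve whose restriction to a small neighborhood of each parameter is a geodesic. For $\kappa\in\mathbb R$ let $R_\kappa\in(0,\infty]$ be the diameter of the complete simply connected surface $M^2_\kappa$ of constant curvature $\kappa$. A $\mathrm{CAT}(\kappa)$ space is a complete metric space in which any two points at distance $<R_\kappa$ are joined by a geodesic and all geodesic triangles of perimeter $<2R_\kappa$ are not thicker than their comparison triangles in $M^2_\kappa$. A metric space has curvature bounded above by $\kappa$ if every point has a $\mathrm{CAT}(\kappa)$ neighborhood. Such a space is locally geodesically complete if every local geodesic $\gamma:[a,b]\to X$, $a<b$, extends as a local geodesic to a larger interval $[a-\epsilon,b+\epsilon]$, $\epsilon>0$. A GCBA space is a separable, locally compact, locally geodesically complete metric space with curvature bounded above by some $\kappa\in\mathbb R$. The space of directions $\Sigma_x=\Sigma_xX$ is the completion of the set of starting directions of geodesics at $x$ with the angle metric. Tiny balls: in a GCBA space $X$ of curvature $\le\kappa$ an open ball $U=B_{r_0}(x_0)$ is tiny if $r_0\le\min\{1,\frac1{100}R_\kappa\}$ and the closed ball $\bar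 B_{10r_0}(x_0)$ is compact and $\mathrm{CAT}(\kappa)$. Put $\tilde U=\bar B_{5r_0}(x_0)$. For points $x\ne y$ of $\tilde U$, $xy$ is the unique geodesic between them and $(xy)'\in\Sigma_x$ its starting direction. Almost spherical tuples: two points $v,\bar v\in\Sigma_x$ are opposite $\delta$-spherical points if $d(v,w)+d(w,\bar v)<\pi+\delta$ for all $w\in\Sigma_x$. Two $k$-tuples $(v_i),(\bar v_i)$ in $\Sigma_x$ are opposite $\delta$-spherical $k$-tuples if $v_i,\bar v_i$ are opposite $\delta$-spherical points for every $i$, and $d(v_i,\bar v_j)<\frac\pi2+\delta$, $d(v_i,v_j)<\frac\pi2+\delta$, $d(\bar v_i,\bar v_j)<\frac\pi2+\delta$ for all $i\ne j$. A $k$-tuple is $\delta$-spherical if it has an opposite $\delta$-spherical $k$-tuple. A $k$-tuple $(p_i)$ of points of $\tilde U\setminus\{x\}$ is a $(k,\delta)$-strainer at $x\in U$ if $((xp_i)')$ is a $\delta$-spherical $k$-tuple in $\Sigma_x$. For $V\subset U$, a map $F=(d_{p_1},\dots,d_{p_k}):V\to\mathbb R^k$, where $d_p(x)=d(p,x)$ and $p_i\in\tilde U$, is a $(k,\delta)$-strainer map in $V$ if $(p_i)$ is a $(k,\delta)$-strainer at every point of $V$. Balls in a fiber are taken with respect to the metric induced from $X$. *)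

(* Defs.v *)
From HB Require Import structures.
From mathcomp Require Import all_boot all_order all_algebra.
From mathcomp Require Import all_classical all_reals all_analysis.
Set Implicit Arguments.
Unset Strict Implicit.
Unset Printing Implicit Defensive.
Import Order.TTheory GRing.Theory Num.Theory.
Import numFieldTopology.Exports.
Local Open Scope classical_set_scope.
Local Open Scope ring_scope.

(* Curves are total functions on [R]; only their values on the interval under
   consideration matter.  The distance [d] is a parameter so that the same
   definitions apply to metric spaces and to the model surfaces below. *)
Section Geodesics.
Context {R : realType} {T : Type}.
Variable d : T -> T -> R.

Definition isometric_on (I : set R) (c : R -> T) : Prop :=
  forall s t, I s -> I t -> d (c s) (c t) = `|s - t|.

Definition geodesic_in (A : set T) (x y : T) (c : R -> T) : Prop :=
  [/\ c 0 = x, c (d x y) = y,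
      (forall t, t \in `[0, d x y] -> A (c t)) &
      isometric_on `[0, d x y] c].

Definition local_geodesic (a b : R) (c : R -> T) : Prop :=
  forall t, t \in `[a, b] ->
    exists2 e, 0 < e & isometric_on (`[a, b] `&` ball t e) c.

(* Vertices and sides are indexed by 'I_3 = Z/3, the side [c i] running from
   [p i] to [p (i + 1)]. *)
Definition geodesic_triangle (A : set T) (p : 'I_3 -> T) (c : 'I_3 -> R -> T)
  : Prop := forall i, geodesic_in A (p i) (p (i + 1)) (c i).

Definition perimeter (p : 'I_3 -> T) : R := \sum_i d (p i) (p (i + 1)).

End Geodesics.

Section ModelSurface.
Context {R : realType}.
Implicit Types (kappa : R) (v w : 'rV[R]_3).

Definition model_form kappa v w : R :=
  v 0 0 * w 0 0 + Num.sg kappa * (v 0 1 * w 0 1 + v 0 2%:R * w 0 2%:R).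

(* The unit sphere if kappa > 0, the affine plane {1} x R^2 if kappa = 0, and
   the upper sheet of the unit hyperboloid if kappa < 0. *)
Definition model_surface kappa : set 'rV[R]_3 :=
  [set v | model_form kappa v v = 1 /\ (kappa <= 0 -> 0 < v 0 0)].

Definition arcosh (x : R) : R := ln (x + Num.sqrt (x ^+ 2 - 1)).

Definition model_dist kappa v w : R :=
  if 0 < kappa then acos (model_form kappa v w) / Num.sqrt kappa
  else if kappa == 0
       then Num.sqrt ((v 0 1 - w 0 1) ^+ 2 + (v 0 2%:R - w 0 2%:R) ^+ 2)
       else arcosh (model_form kappa v w) / Num.sqrt (- kappa).

Definition model_diam kappa : \bar R :=
  ereal_sup [set (model_dist kappa v w)%:E
            | v in model_surface kappa & w in model_surface kappa].

End ModelSurface.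

Section GCBA.
Context {R : realType} {X : metricType R}.
Implicit Types (kappa r : R) (A : set X) (x y : X).

Local Notation d := (@mdist R X).

(* The library's [closed_ball] is the closure of the open ball. *)
Definition cball x r : set X := [set y | d x y <= r].

Definition complete_subset A : Prop :=
  forall u : nat -> X, (forall n, A (u n)) -> cauchy (u @ \oo) ->
    exists2 l, A l & u @ \oo --> l.

Definition thin_triangles kappa A : Prop :=
  forall p c p' c',
    geodesic_triangle d A p c ->
    ((perimeter d p)%:E < 2%:E * model_diam kappa)%E ->
    geodesic_triangle (model_dist kappa) (model_surface kappa) p' c' ->
    (forall i, model_dist kappa (p' i) (p' (i + 1)) = d (p i) (p (i + 1))) ->
    forall i j s t,
      s \in `[0, d (p i) (p (i + 1))] -> t \in `[0, d (p j) (p (j + 1))] ->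
      d (c i s) (c j t) <= model_dist kappa (c' i s) (c' j t).

Definition CAT kappa A : Prop :=
  [/\ complete_subset A,
      (forall x y, A x -> A y -> ((d x y)%:E < model_diam kappa)%E ->
         exists c, geodesic_in d A x y c) &
      thin_triangles kappa A].

Definition locally_geodesically_complete : Prop :=
  forall (c : R -> X) (a b : R), a < b -> local_geodesic d a b c ->
    exists2 e, 0 < e &
    exists2 c', local_geodesic d (a - e) (b + e) c' &
                forall t, t \in `[a, b] -> c' t = c t.

End GCBA.

Section Spaces.
Context {R : realType}.

Definition curvature_le (kappa : R) (X : metricType R) : Prop :=
  forall x : X, exists2 A, nbhs x A & CAT kappa A.

Definition GCBA (X : metricType R) : Prop :=
  [/\ exists2 S : set X, countable S & dense S,
      locally_compact [set: X],
      @locally_geodesically_complete R X &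
      exists kappa, curvature_le kappa X].

End Spaces.

Section Directions.
Context {R : realType} {X : metricType R}.
Implicit Types (x y : X) (c : R -> X).

Local Notation d := (@mdist R X).

Definition geodesic_from x c : Prop :=
  c 0 = x /\ exists2 l, 0 < l & isometric_on d `[0, l] c.

(* The upper Alexandrov angle, that is, the limit superior as s, t -> 0+ of the
   Euclidean comparison angles at c 0 = c' 0 between c s and c' t. *)
Definition angle c c' : R :=
  fine (limf_esup
    (fun st : R * R =>
       (acos ((st.1 ^+ 2 + st.2 ^+ 2 - d (c st.1) (c' st.2) ^+ 2)
              / (2 * st.1 * st.2)))%:E)
    (filter_prod 0^'+ 0^'+)).

(* The completion of the set of starting directions at x, represented by the
   angle-Cauchy sequences of geodesics starting at x.  Sequences at distance 0
   are not identified: only the distances between points are used below. *)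
Definition directions x : set (nat -> R -> X) :=
  [set v | (forall n, geodesic_from x (v n)) /\
    forall e, 0 < e -> exists N, forall m n,
      (N <= m)%N -> (N <= n)%N -> angle (v m) (v n) < e].

Definition dir_dist (v w : nat -> R -> X) : R :=
  lim (angle (v n) (w n) @[n --> \oo]).

Definition geod x y : R -> X :=
  xget (fun=> x) [set c | geodesic_in d [set: X] x y c].

Definition dir x y : nat -> R -> X := fun=> geod x y.

Implicit Types delta : R.

Definition opposite_spherical_points x delta (v v' : nat -> R -> X) : Prop :=
  [/\ directions x v, directions x v' &
      forall w, directions x w -> dir_dist v w + dir_dist w v' < pi + delta].

Definition opposite_spherical_tuples x delta (k : nat)
    (v v' : 'I_k -> nat -> R -> X) : Prop :=
  (forall i, opposite_spherical_points x delta (v i) (v' i)) /\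
  (forall i j, i != j ->
     [/\ dir_dist (v i) (v' j) < pi / 2 + delta,
         dir_dist (v i) (v j) < pi / 2 + delta &
         dir_dist (v' i) (v' j) < pi / 2 + delta]).

Definition spherical_tuple x delta (k : nat) (v : 'I_k -> nat -> R -> X)
  : Prop := exists v', opposite_spherical_tuples x delta v v'.

End Directions.

Section Strainers.
Context {R : realType} {X : metricType R}.
Implicit Types (kappa delta : R) (x : X) (k : nat) (V : set X).

Definition tiny_ball kappa (x0 : X) (r0 : R) : Prop :=
  [/\ 0 < r0, r0 <= 1, (r0%:E <= (100^-1)%:E * model_diam kappa)%E,
      compact (cball x0 (10 * r0)) & CAT kappa (cball x0 (10 * r0))].

Definition strainer (x0 : X) (r0 : R) delta k (p : 'I_k -> X) x : Prop :=
  (forall i, cball x0 (5 * r0) (p i) /\ p i <> x) /\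
  spherical_tuple x delta (fun i => dir x (p i)).

Definition dist_map k (p : 'I_k -> X) (x : X) : 'rV[R]_k :=
  \row_i mdist (p i) x.

Definition strainer_map (x0 : X) (r0 : R) delta k (p : 'I_k -> X) V : Prop :=
  (forall i, cball x0 (5 * r0) (p i)) /\
  (forall x, V x -> strainer x0 r0 delta p x).

End Strainers.

Definition open_map_on {X Y : topologicalType} (V : set X) (f : X -> Y) : Prop :=
  forall O, open O -> open (f @` (V `&` O)).

Definition contractible (R : realType) {X : topologicalType} (A : set X) : Prop :=
  exists2 a, A a & exists H : R * X -> X,
    [/\ {within `[0, 1] `*` A, continuous H},
        (forall t x, t \in `[0, 1] -> A x -> A (H (t, x))),
        (forall x, A x -> H (0, x) = x) &
        (forall x, A x -> H (1, x) = a)].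

(* Main.v *)
(* Fix a point x of V, the strainer points p_i, and points q_i near x on geodesics
   whose directions approximate an opposite spherical tuple.  First variation at
   x, compactness, geodesic extension and convexity of distance functions in the
   CAT ball give two facts, uniform in a neighborhood of x: each
   d(p_i, -) + d(q_i, -) is 2 delta-Lipschitz, and moving towards p_i or q_i
   increases d(p_j, -) and d(q_j, -), j <> i, at rate at most 2 delta.  So each
   coordinate of F can be prescribed with an error in all coordinates of at most
   4 delta times the length of the move.  As 4 k delta <= 1/5, correcting all
   coordinates in turn divides the l1-distance from F(y) to a target omega by 5,
   and iterating gives a continuous retraction Phi onto the fiber over omega that
   moves y by at most 5/4 of this distance.  Openness follows at once.  For the
   contraction, let y_s be the point on the geodesic from y to x at fraction s.
   If F(y) = F(x), the same two facts show that F(y_s) is within s d(x, y) / 5 of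
   F(x), hence Phi(y_s) stays at distance at most d(x, y) from x, and
   s |-> Phi(y_s) contracts the ball of the fiber to x. *)
Require Import Defs.
From HB Require Import structures.
From mathcomp Require Import all_boot all_order all_algebra.
From mathcomp Require Import all_classical all_reals all_analysis.
From mathcomp Require Import ring lra.
Set Implicit Arguments.
Unset Strict Implicit.
Unset Printing Implicit Defensive.
Import Order.TTheory GRing.Theory Num.Theory.
Import numFieldTopology.Exports.
Local Open Scope classical_set_scope.
Local Open Scope ring_scope.

(** * Comparison triangles in the model surfaces *)

Section ModelSurface.
Context {R : realType}.
Implicit Types (kappa x y t : R) (v w : 'rV[R]_3).

(** The curvature bound speaks only of comparison triangles, so these have to be built in each model
    surface. Afterwards it survives through two statements about distances: uniqueness of geodesics
    and convexity of distances at midpoints. Tininess supplies the room, as three points of the ball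
    of radius 10 r0 have perimeter at most 60 r0, while the model diameter is at least 100 r0. The
    obstacle further on is that the strainer condition is infinitesimal and lives at one point. The
    angle errors are kept at 3/2 delta and the rates at 2 delta, so that the first order bounds are
    strict; strict bounds persist at one fixed scale for all nearby points. For segments between
    arbitrary nearby points a common scale exists because such segments prolong to a common length,
    which is where geodesic completeness enters. The factor 5/4 is the sum of the powers of 1/5: the
    total length of the successive corrections, relative to the first one. *)

Definition row3 x y t : 'rV[R]_3 :=
  \row_(i < 3) (if i == 0 then x else if i == 1 then y else t).

Lemma model_form_row3 kappa x y t x' y' t' :
  model_form kappa (row3 x y t) (row3 x' y' t') =
  x * x' + Num.sg kappa * (y * y' + t * t').
Proof. by rewrite /model_form !mxE. Qed.

Lemma row30 x y t : row3 x y t 0 0 = x.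
Proof. by rewrite mxE. Qed.

(** Treats sphere and hyperbolic plane at once: [C], [S] are cos, sin or cosh, sinh, rescaled by the
    root of |kappa|, and the sign of kappa makes [Num.sg kappa * C] decreasing in both cases. The
    bound [b] is pi / sqrt kappa on the sphere and arbitrary on the hyperbolic plane. The clause
    [ct_sg] excludes kappa = 0, where [model_form] no longer determines distances. *)
Record curvature_trig kappa (C S : R -> R) (b : R) : Prop := {
  ct_sg : Num.sg kappa ^+ 2 = 1;
  ct_CB : forall x y, C (x - y) = C x * C y + Num.sg kappa * (S x * S y);
  ct_SB : forall x y, S (x - y) = S x * C y - C x * S y;
  ct_0 : C 0 = 1 /\ S 0 = 0;
  ct_mono : forall x y, 0 <= x -> x < y -> y <= b ->
    Num.sg kappa * C y < Num.sg kappa * C x;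
  ct_Sgt0 : forall x, 0 < x -> x < b -> 0 < S x;
  ct_Cgt0 : forall x, 0 <= x -> x < b / 2 -> 0 < C x;
  ct_Cneg : forall x, kappa <= 0 -> 0 < C x;
  ct_dist : forall v w x, model_surface kappa v -> model_surface kappa w ->
    0 <= x -> x <= b -> model_form kappa v w = C x -> model_dist kappa v w = x;
  ct_form : forall v w x, model_surface kappa v -> model_surface kappa w ->
    0 <= x -> x <= model_dist kappa v w ->
    Num.sg kappa * model_form kappa v w <= Num.sg kappa * C x }.

Section Trig.
Variables (kappa : R) (C S : R -> R) (b : R).
Hypothesis CS : curvature_trig kappa C S b.
Local Notation s := (Num.sg kappa).

Lemma ct_CN x : C (- x) = C x.
Proof.
have [C0 S0] := ct_0 CS.
by rewrite -sub0r (ct_CB CS) C0 S0 mul1r mul0r mulr0 addr0.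
Qed.

Lemma ct_SN x : S (- x) = - S x.
Proof.
have [C0 S0] := ct_0 CS.
by rewrite -sub0r (ct_SB CS) C0 S0 mul1r mul0r sub0r.
Qed.

Lemma ct_C_norm x : C `|x| = C x.
Proof. by case: (ger0P x) => _ //; rewrite ct_CN. Qed.

Lemma ct_CD x y : C (x + y) = C x * C y - s * (S x * S y).
Proof. by rewrite -[y]opprK (ct_CB CS) !ct_CN !ct_SN opprK; ring. Qed.

Lemma ct_SD x y : S (x + y) = S x * C y + C x * S y.
Proof. by rewrite -[y]opprK (ct_SB CS) !ct_CN !ct_SN opprK; ring. Qed.

Lemma ct_sqr x : C x ^+ 2 + s * S x ^+ 2 = 1.
Proof. by have := ct_CB CS x x; rewrite subrr (ct_0 CS).1 => <-; ring. Qed.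

Lemma ct_mono_le x y : 0 <= x -> x <= y -> y <= b -> s * C y <= s * C x.
Proof.
move=> x0; rewrite le_eqVlt => /predU1P[-> //|xy] yb.
exact/ltW/(ct_mono CS).
Qed.

(** The curve is spherical linear interpolation and its hyperbolic analogue. By bilinearity and the
    addition formulas the form of its points at r and t is C (r - t), whence it is isometric. *)
Lemma model_geodesic v w L :
  model_surface kappa v -> model_surface kappa w ->
  0 < L -> L < b -> model_form kappa v w = C L ->
  exists2 c, geodesic_in (model_dist kappa) (model_surface kappa) v w c &
    forall t, c t = (S (L - t) / S L) *: v + (S t / S L) *: w.
Proof.
move=> Mv Mw L0 Lb vw; have [C0 S0] := ct_0 CS.
have dvw : model_dist kappa v w = L.
  by apply: (ct_dist CS) => //; exact: ltW.
pose c t := (S (L - t) / S L) *: v + (S t / S L) *: w.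
have SL0 : S L != 0 by rewrite gt_eqF// (ct_Sgt0 CS).
have formC r t : model_form kappa (c r) (c t) = C (r - t).
  have -> : model_form kappa (c r) (c t) =
    (S (L - r) * S (L - t) + S r * S t + C L * (S (L - r) * S t + S r * S (L - t)))
      / S L ^+ 2.
    have [[vv _] [ww _]] := (Mv, Mw); rewrite -vw.
    move: vv ww; rewrite /model_form !mxE.
    move: (v 0 0) (v 0 1) (v 0 2%:R) (w 0 0) (w 0 1) (w 0 2%:R).
    move=> v0 v1 v2 w0 w1 w2 vv ww.
    transitivity
     ((S (L - r) * S (L - t) * (v0 * v0 + s * (v1 * v1 + v2 * v2)) +
       S r * S t * (w0 * w0 + s * (w1 * w1 + w2 * w2)) +
       (v0 * w0 + s * (v1 * w1 + v2 * w2)) * (S (L - r) * S t + S r * S (L - t)))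
       / S L ^+ 2); last by rewrite vv ww !mulr1.
    by field.
  rewrite !(ct_SB CS) !(ct_CB CS).
  have := ct_sqr L.
  move: (C L) (S L) (C r) (S r) (C t) (S t) SL0 => CL SL Cr Sr Ct St SL0 sq.
  have eq1 : Cr * Ct + s * (Sr * St) - ((SL * Cr - CL * Sr) * (SL * Ct - CL * St)
     + Sr * St + CL * ((SL * Cr - CL * Sr) * St + Sr * (SL * Ct - CL * St))) / SL ^+ 2
     = Sr * St * (CL ^+ 2 + s * SL ^+ 2 - 1) / SL ^+ 2 by field.
  apply/esym/eqP; rewrite -subr_eq0 eq1 sq subrr.
  by rewrite mulr0 mul0r.
have c0 : c 0 = v.
  by rewrite /c subr0 S0 mul0r scale0r addr0 divff// scale1r.
have cL : c L = w.
  by rewrite /c subrr S0 mul0r scale0r add0r divff// scale1r.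
have Mc t : t \in `[0, L] -> model_surface kappa (c t).
  rewrite in_itv/= => /andP[t0 tL]; split; first by rewrite formC subrr.
  move=> k0; have [[_ /(_ k0) v0] [_ /(_ k0) w0]] := (Mv, Mw).
  have SS x : 0 <= x -> x <= L -> 0 <= S x.
    rewrite le_eqVlt => /predU1P[<- _|x0 xL]; first by rewrite S0.
    by apply/ltW/(ct_Sgt0 CS) => //; exact: le_lt_trans Lb.
  rewrite /c !mxE.
  have [t0'|t0'] := eqVneq t 0.
    by rewrite t0' subr0 S0 divff// mul1r !mul0r addr0.
  apply: ltr_wpDl.
    apply: mulr_ge0; last exact: ltW.
    by apply: divr_ge0; apply: SS => //; rewrite ?subr_ge0 ?gerBl// ltW.
  apply: mulr_gt0 => //; apply: divr_gt0.
    apply: (ct_Sgt0 CS) => //; first by rewrite lt_def t0'.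
    exact: le_lt_trans Lb.
  exact: (ct_Sgt0 CS).
exists c => //; rewrite /geodesic_in dvw; split => //.
move=> r t /= rL tL; apply: (ct_dist CS); [exact: Mc|exact: Mc|done| |].
  move: rL tL; rewrite !in_itv/= => /andP[r0 rL] /andP[t0 tL].
  by rewrite ler_norml; apply/andP; split; lra.
by rewrite formC ct_C_norm.
Qed.

(** The side of length L is put on the first coordinate plane. The law of cosines then forces the
    second coordinate [p1] of the remaining vertex, and its third coordinate exists because p1^2 <=
    (S x)^2, which is the triangle inequality read through the monotonicity of [C]. *)
Lemma comparison_triangle x y L :
  0 <= x -> 0 <= y -> 0 < L -> x <= y + L -> y <= x + L -> L <= x + y ->
  x + L < b -> y <= b ->
  exists v u w, [/\ [/\ model_surface kappa v, model_surface kappa u &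
     model_surface kappa w], model_form kappa v u = C x,
     model_form kappa v w = C y & model_form kappa u w = C L].
Proof.
move=> x0 y0 L0 xyL yxL Lxy xLb yb.
have Lb : L < b by lra.
have SL : 0 < S L by exact: (ct_Sgt0 CS).
have Sx : 0 <= S x.
  move: x0; rewrite le_eqVlt => /predU1P[<-|x0]; first by rewrite (ct_0 CS).2.
  by apply/ltW/(ct_Sgt0 CS) => //; lra.
have s2 := ct_sg CS.
have up : s * C y <= s * C (x - L).
  rewrite -[C (x - L)]ct_C_norm; apply: ct_mono_le => //.
  by rewrite ler_norml; apply/andP; split; lra.
have lo : s * C (x + L) <= s * C y by apply: ct_mono_le => //; lra.
rewrite (ct_CB CS) in up; rewrite ct_CD in lo.
pose p1 := s * (C y - C x * C L) / S L.
have p1S : p1 ^+ 2 <= S x ^+ 2.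
  rewrite -ler_sqrt ?sqr_ge0// !sqrtr_sqr (ger0_norm Sx) ler_norml.
  rewrite /p1 ler_pdivlMr// ler_pdivrMr//.
  apply/andP; split.
    have : s ^+ 2 * (S x * S L) = S x * S L by rewrite s2 mul1r.
    lra.
  have : s ^+ 2 * (S x * S L) = S x * S L by rewrite s2 mul1r.
  lra.
pose p2 := Num.sqrt (S x ^+ 2 - p1 ^+ 2).
have p2E : p2 ^+ 2 = S x ^+ 2 - p1 ^+ 2 by rewrite sqr_sqrtr// subr_ge0.
exists (row3 (C x) p1 p2), (row3 1 0 0), (row3 (C L) (S L) 0).
rewrite !model_form_row3.
split; [split|by ring| |by ring].
- split; last by move=> k0; rewrite row30; exact: (ct_Cneg CS).
  by rewrite model_form_row3 -!expr2 p2E -[RHS](ct_sqr x); ring.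
- split; last by rewrite row30.
  by rewrite model_form_row3; ring.
- split; last by move=> k0; rewrite row30; exact: (ct_Cneg CS).
  by rewrite model_form_row3 -[RHS](ct_sqr L); ring.
- have : s * (p1 * S L) = s ^+ 2 * (C y - C x * C L).
    rewrite /p1 -mulrA; field.
    by rewrite gt_eqF.
  by rewrite s2; lra.
Qed.

End Trig.
End ModelSurface.

Section Triple.
Variable T : Type.

Definition triple (a b c : T) (i : 'I_3) : T :=
  if i == 0 then a else if i == 1 then b else c.

Lemma triple_ind (P : 'I_3 -> Prop) : P 0 -> P 1 -> P 2%:R -> forall i, P i.
Proof.
move=> P0 P1 P2 [[|[|[|//]]] i3].
- by rewrite (_ : Ordinal i3 = 0)//; exact: val_inj.
- by rewrite (_ : Ordinal i3 = 1)//; exact: val_inj.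
- by rewrite (_ : Ordinal i3 = 2%:R)//; exact: val_inj.
Qed.

Lemma ord3_succ : ((0 + 1 = 1 :> 'I_3)%R * (1 + 1 = 2%:R :> 'I_3)%R *
  (2%:R + 1 = 0 :> 'I_3)%R)%type.
Proof. by do !split; exact: val_inj. Qed.

Lemma tripleE a b c :
  (triple a b c 0 = a) * (triple a b c 1 = b) * (triple a b c 2%:R = c).
Proof. by []. Qed.

End Triple.

Section ThinTriangles.
Context {R : realType} {X : metricType R}.
Variables (kappa : R) (A : set X).
Hypothesis thinA : thin_triangles kappa A.
Local Notation d := (@mdist R X).
Local Notation D := (model_dist kappa).
Local Notation M := (model_surface kappa).

(** Each vertex is the start of its own side, so parameter 0 on side 2 turns the comparison of two
    sides into that of a vertex with the opposite side. *)
Lemma thin_vertex x y z c1 c2 c3 x' y' z' c1' c2' c3' t :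
  geodesic_in d A x y c1 -> geodesic_in d A y z c2 -> geodesic_in d A z x c3 ->
  ((d x y + d y z + d z x)%:E < 2%:E * model_diam kappa)%E ->
  geodesic_in D M x' y' c1' -> geodesic_in D M y' z' c2' ->
  geodesic_in D M z' x' c3' ->
  D x' y' = d x y -> D y' z' = d y z -> D z' x' = d z x ->
  t \in `[0, d x y] -> d z (c1 t) <= D z' (c1' t).
Proof.
move=> g1 g2 g3 per g1' g2' g3' e1 e2 e3 txy.
have [c30 _ _ _] := g3; have [c30' _ _ _] := g3'.
suff : d (triple c1 c2 c3 2%:R 0) (triple c1 c2 c3 0 t) <=
    D (triple c1' c2' c3' 2%:R 0) (triple c1' c2' c3' 0 t).
  by rewrite !tripleE c30 c30'.
apply: (thinA (p := triple x y z) (p' := triple x' y' z')).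
- by apply: triple_ind; rewrite !ord3_succ !tripleE.
- rewrite /perimeter big_ord_recl big_ord_recl big_ord1.
  have -> : lift ord0 (ord0 : 'I_2) = (1 : 'I_3) by exact: val_inj.
  have -> : lift ord0 (lift ord0 (ord0 : 'I_1)) = (2%:R : 'I_3) by exact: val_inj.
  have -> : (ord0 : 'I_3) = 0 by exact: val_inj.
  by rewrite !ord3_succ !tripleE addrA.
- by apply: triple_ind; rewrite !ord3_succ !tripleE.
- by apply: triple_ind; rewrite !ord3_succ !tripleE.
- by rewrite ord3_succ !tripleE in_itv/= lexx mdist_ge0.
- by rewrite ord3_succ !tripleE.
Qed.

Section Curved.
Variables (C S : R -> R) (b : R).
Hypothesis CS : curvature_trig kappa C S b.
Local Notation s := (Num.sg kappa).

(** Stewart's theorem in curved form: the comparison point is an explicit combination of x' and y',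
    so its form with z' is the same combination of cosines of the sides. *)
Lemma thin_curved x y z c1 c2 c3 t :
  geodesic_in d A x y c1 -> geodesic_in d A y z c2 -> geodesic_in d A z x c3 ->
  0 < d x y -> 0 < d y z -> 0 < d z x ->
  d x y + d z x < b -> d y z < b ->
  ((d x y + d y z + d z x)%:E < 2%:E * model_diam kappa)%E ->
  t \in `[0, d x y] ->
  s * (S (d x y - t) * C (d z x) + S t * C (d y z)) <=
  s * (S (d x y) * C (d z (c1 t))).
Proof.
move=> g1 g2 g3 xy0 yz0 zx0 xyzx yzb per txy.
have t1 := metric_triangle z y x.
have t2 := metric_triangle y x z.
have t3 := metric_triangle x z y.
rewrite (metric_sym z y) (metric_sym y x) in t1.
rewrite (metric_sym y x) (metric_sym x z) in t2.
rewrite (metric_sym x z) (metric_sym z y) in t3.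
have [] := @comparison_triangle _ _ _ _ _ CS (d z x) (d y z) (d x y).
all: rewrite ?mdist_ge0//; try lra.
move=> z' [x' [y' [[Mz Mx My] zx zy xy]]].
have sym v w : model_form kappa v w = model_form kappa w v.
  by rewrite /model_form; ring.
have dE v w l : M v -> M w -> 0 < l -> l < b ->
    model_form kappa v w = C l -> D v w = l.
  by move=> Mv Mw l0 lb /(ct_dist CS Mv Mw (ltW l0) (ltW lb)).
have [lxy lzx] : d x y < b /\ d z x < b by split; lra.
have [c1' g1' c1'E] := model_geodesic CS Mx My xy0 lxy xy.
rewrite sym in zy.
have [c2' g2' _] := model_geodesic CS My Mz yz0 yzb zy.
have [c3' g3' _] := model_geodesic CS Mz Mx zx0 lzx zx.
have exy := dE _ _ _ Mx My xy0 lxy xy.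
have := thin_vertex g1 g2 g3 per g1' g2' g3' exy
  (dE _ _ _ My Mz yz0 yzb zy) (dE _ _ _ Mz Mx zx0 lzx zx) txy.
have Mc : M (c1' t) by have [_ _ + _] := g1'; rewrite exy; exact.
move=> /(ct_form CS Mz Mc (mdist_ge0 _ _)).
have SL := ct_Sgt0 CS xy0 lxy.
have -> : model_form kappa z' (c1' t) =
    (S (d x y - t) * C (d z x) + S t * C (d y z)) / S (d x y).
  rewrite -zx -zy [in RHS]sym c1'E /model_form !mxE.
  by field; rewrite gt_eqF.
rewrite mulrA ler_pdivrMr// => /le_trans; apply.
by rewrite -!mulrA [S _ * _]mulrC.
Qed.

End Curved.
End ThinTriangles.

(** * Trigonometry of the sphere and of the hyperbolic plane *)

Section CurvatureTrig.
Context {R : realType}.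
Implicit Types (kappa x y b : R) (v w : 'rV[R]_3).

Lemma spherical_form_itv kappa v w : 0 < kappa ->
  model_surface kappa v -> model_surface kappa w ->
  -1 <= model_form kappa v w <= 1.
Proof.
move=> k0 [+ _] [+ _]; rewrite /model_form gtr0_sg//.
move: (v 0 0) (v 0 1) (v 0 2%:R) (w 0 0) (w 0 1) (w 0 2%:R).
move=> v0 v1 v2 w0 w1 w2 vv ww.
have := sqr_ge0 (v0 - w0); have := sqr_ge0 (v1 - w1); have := sqr_ge0 (v2 - w2).
have := sqr_ge0 (v0 + w0); have := sqr_ge0 (v1 + w1); have := sqr_ge0 (v2 + w2).
by move=> *; apply/andP; split; lra.
Qed.

Lemma model_diam_pos_le kappa : 0 < kappa ->
  (model_diam kappa <= (pi / Num.sqrt kappa)%:E)%E.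
Proof.
move=> k0; apply: ge_ereal_sup => _ [v Mv [w Mw <-]].
rewrite lee_fin /model_dist k0 ler_pM2r ?invr_gt0 ?sqrtr_gt0//.
exact: acos_lepi (spherical_form_itv k0 Mv Mw).
Qed.

Lemma spherical_trig kappa (l := Num.sqrt kappa) : 0 < kappa ->
  curvature_trig kappa (fun x => cos (l * x)) (fun x => sin (l * x)) (pi / l).
Proof.
move=> k0; have l0 : 0 < l by rewrite sqrtr_gt0.
have sg1 : Num.sg kappa = 1 by rewrite gtr0_sg.
have le_l x : x <= pi / l -> l * x <= pi by rewrite [l * x]mulrC ler_pdivlMr.
have lt_l x y : x < y / l -> l * x < y by rewrite [l * x]mulrC ltr_pdivlMr.
split; rewrite ?sg1.
- by rewrite expr1n.
- by move=> x y; rewrite mulrBr cosB mul1r.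
- by move=> x y; rewrite mulrBr sinB.
- by rewrite mulr0 cos0 sin0.
- move=> x y x0 xy /le_l yb; rewrite !mul1r ltr_cos ?in_itv/= ?ltr_pM2l//.
    rewrite mulr_ge0 ?(ltW l0)//=; apply: le_trans yb.
    by rewrite ler_pM2l// ltW.
  by rewrite yb mulr_ge0 ?(ltW l0)// (le_trans x0)// ltW.
- by move=> x x0 /lt_l xb; apply: sin_gt0_pi; rewrite xb mulr_gt0.
- move=> x x0; rewrite mulrAC => /lt_l xb; apply: cos_gt0_pihalf.
  rewrite xb andbT (@lt_le_trans _ _ 0)//; last by rewrite mulr_ge0// ltW.
  by rewrite oppr_lt0 divr_gt0// pi_gt0.
- by move=> x; rewrite leNgt k0.
- move=> v w x _ _ x0 /le_l xb vw; rewrite /model_dist k0 vw cosK.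
    by rewrite mulrC mulKf// gt_eqF.
  by rewrite in_itv/= xb mulr_ge0// ltW.
- move=> v w x Mv Mw x0; rewrite /model_dist k0 ler_pdivlMr// => xf.
  have fI := spherical_form_itv k0 Mv Mw.
  have a0 := acos_ge0 fI; have api := acos_lepi fI.
  have lx0 : 0 <= l * x by rewrite mulr_ge0// ltW.
  rewrite mulrC in xf.
  rewrite !mul1r -[leLHS](acosK (x := _)) ?in_itv// leNgt ltr_cos ?in_itv/=.
  + by rewrite -leNgt.
  + by rewrite a0.
  + by rewrite lx0 (le_trans xf).
Qed.

Definition cosh x : R := (expR x + expR (- x)) / 2.
Definition sinh x : R := (expR x - expR (- x)) / 2.

Lemma expRN_mul x : expR x * expR (- x) = 1.
Proof. by rewrite -expRD subrr expR0. Qed.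

Lemma lt_cosh x y : 0 <= x -> x < y -> cosh x < cosh y.
Proof.
move=> x0 xy; rewrite /cosh ltr_pM2r// -subr_gt0.
have -> : expR y + expR (- y) - (expR x + expR (- x)) =
  (expR y - expR x) * (1 - expR (- (x + y))).
  have := expRN_mul x; have := expRN_mul y; rewrite [- (x + y)]opprD expRD.
  move: (expR x) (expR (- x)) (expR y) (expR (- y)) => a a' c c' h1 h2.
  transitivity (c + c' * (a * a') - (a + a' * (c * c'))); last by ring.
  by rewrite h1 h2 !mulr1.
rewrite mulr_gt0// subr_gt0 ?ltr_expR// expR_lt1; lra.
Qed.

Lemma le_cosh x y : 0 <= x -> x <= y -> cosh x <= cosh y.
Proof.
by move=> x0; rewrite le_eqVlt => /predU1P[-> //|xy]; exact/ltW/lt_cosh.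
Qed.

Lemma cosh_gt0 x : 0 < cosh x.
Proof. by rewrite divr_gt0// addr_gt0// expR_gt0. Qed.

Lemma sinh_ge0 x : 0 <= x -> 0 <= sinh x.
Proof.
move=> x0; rewrite divr_ge0// subr_ge0 ler_expR; lra.
Qed.

Lemma arcosh_cosh x : 0 <= x -> arcosh (cosh x) = x.
Proof.
move=> x0; rewrite /arcosh (_ : _ - 1 = sinh x ^+ 2).
  rewrite sqrtr_sqr ger0_norm ?sinh_ge0// /cosh /sinh.
  by rewrite -[RHS]expRK; congr ln; field.
have -> : cosh x ^+ 2 = sinh x ^+ 2 + expR x * expR (- x).
  by rewrite /cosh /sinh; field.
by rewrite expRN_mul addrK.
Qed.

Lemma cosh_arcosh y : 1 <= y -> 0 <= arcosh y /\ cosh (arcosh y) = y.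
Proof.
move=> y1; set q := Num.sqrt (y ^+ 2 - 1).
have y21 : 0 <= y ^+ 2 - 1 by rewrite subr_ge0 expr_ge1// (le_trans _ y1).
have q0 : 0 <= q by exact: sqrtr_ge0.
have g1 : 1 <= y + q by lra.
have g0 : 0 < y + q by lra.
split; first exact: ln_ge0.
rewrite /cosh expRN /arcosh -/q lnK ?posrE//.
have -> : (y + q)^-1 = y - q.
  apply: (mulfI (lt0r_neq0 g0)); rewrite mulfV ?gt_eqF//.
  by rewrite mulrC -subr_sqr sqr_sqrtr//; ring.
by field.
Qed.

(** Reverse Cauchy-Schwarz inequality on the upper sheet; it reduces to (v0^2 - 1)(w0^2 - 1) <= (v0
    w0 - 1)^2, that is, to (v0 - w0)^2 >= 0. *)
Lemma hyperbolic_form_ge1 kappa v w : kappa < 0 ->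
  model_surface kappa v -> model_surface kappa w -> 1 <= model_form kappa v w.
Proof.
move=> k0 [+ /(_ (ltW k0)) +] [+ /(_ (ltW k0)) +]; rewrite /model_form ltr0_sg//.
move: (v 0 0) (v 0 1) (v 0 2%:R) (w 0 0) (w 0 1) (w 0 2%:R).
move=> v0 v1 v2 w0 w1 w2 vv v0p ww w0p.
have v01 : 1 <= v0.
  rewrite -(@expr_ge1 _ 2) ?(ltW v0p)//.
  by have := sqr_ge0 v1; have := sqr_ge0 v2; lra.
have w01 : 1 <= w0.
  rewrite -(@expr_ge1 _ 2) ?(ltW w0p)//.
  by have := sqr_ge0 w1; have := sqr_ge0 w2; lra.
have vw1 : 0 <= v0 * w0 - 1 by nra.
suff : v1 * w1 + v2 * w2 <= v0 * w0 - 1 by lra.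
apply: le_trans (ler_norm _) _.
rewrite -(@ler_pXn2r _ 2) ?nnegrE// real_normK ?num_real//.
have : (v1 * w1 + v2 * w2) ^+ 2 <= (v1 ^+ 2 + v2 ^+ 2) * (w1 ^+ 2 + w2 ^+ 2).
  by have := sqr_ge0 (v1 * w2 - v2 * w1); lra.
have -> : v1 ^+ 2 + v2 ^+ 2 = v0 ^+ 2 - 1 by lra.
have -> : w1 ^+ 2 + w2 ^+ 2 = w0 ^+ 2 - 1 by lra.
by have := sqr_ge0 (v0 - w0); lra.
Qed.

Lemma hyperbolic_trig kappa b (l := Num.sqrt (- kappa)) : kappa < 0 ->
  curvature_trig kappa (fun x => cosh (l * x)) (fun x => sinh (l * x)) b.
Proof.
move=> k0; have l0 : 0 < l by rewrite sqrtr_gt0 oppr_gt0.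
have sg1 : Num.sg kappa = -1 by rewrite ltr0_sg.
split; rewrite ?sg1.
- by rewrite sqrrN expr1n.
- by move=> x y; rewrite mulrBr /cosh /sinh opprB addrC !expRD; field.
- by move=> x y; rewrite mulrBr /cosh /sinh opprB addrC !expRD; field.
- by rewrite mulr0 /cosh /sinh oppr0 expR0; split; field.
- move=> x y x0 xy _; rewrite !mulN1r ltrN2 lt_cosh ?ltr_pM2l//.
  by rewrite mulr_ge0// ltW.
- move=> x x0 _; rewrite divr_gt0// subr_gt0 ltr_expR.
  have := mulr_gt0 l0 x0; lra.
- by move=> x *; exact: cosh_gt0.
- by move=> x *; exact: cosh_gt0.
- move=> v w x _ _ x0 _ vw.
  rewrite /model_dist vw ltNge (ltW k0)/= (lt_eqF k0) arcosh_cosh ?mulr_ge0// ?ltW//.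
  by rewrite mulrC mulKf// gt_eqF.
- move=> v w x Mv Mw x0; rewrite /model_dist ltNge (ltW k0)/= (lt_eqF k0).
  have [a0 {2}<-] := cosh_arcosh (hyperbolic_form_ge1 k0 Mv Mw).
  rewrite ler_pdivlMr// mulrC => xf.
  by rewrite !mulN1r lerN2 le_cosh// mulr_ge0// ltW.
Qed.

End CurvatureTrig.

(** * Comparison in the Euclidean plane *)

Section FlatTriangles.
Context {R : realType} {X : metricType R}.
Variables (A : set X).
Hypothesis thinA : thin_triangles 0 A.
Local Notation d := (@mdist R X).
Local Notation D := (@model_dist R 0).
Local Notation M := (@model_surface R 0).

Lemma flat_dist (v w : 'rV[R]_3) :
  D v w = Num.sqrt ((v 0 1 - w 0 1) ^+ 2 + (v 0 2%:R - w 0 2%:R) ^+ 2).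
Proof. by rewrite /model_dist ltxx eqxx. Qed.

Lemma flat_head (v : 'rV[R]_3) : M v -> v 0 0 = 1.
Proof.
move=> [+ /(_ (lexx _)) v0]; rewrite /model_form sgr0 mul0r addr0 => vv.
by apply/eqP; rewrite -sqrp_eq1 ?(ltW v0)// expr2 vv.
Qed.

Lemma flat_geodesic (v w : 'rV[R]_3) (L := D v w) : M v -> M w ->
  0 < L ->
  exists2 c, geodesic_in D M v w c &
    forall t, c t = (1 - t / L) *: v + (t / L) *: w.
Proof.
move=> Mv Mw L0; set c := fun t => (1 - t / L) *: v + (t / L) *: w.
have L2 : (v 0 1 - w 0 1) ^+ 2 + (v 0 2%:R - w 0 2%:R) ^+ 2 = L ^+ 2.
  by rewrite /L flat_dist sqr_sqrtr// addr_ge0// sqr_ge0.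
exists c => //; split.
- by rewrite /c mul0r subr0 scale1r scale0r addr0.
- by rewrite /c -/L divff ?gt_eqF// subrr scale1r scale0r add0r.
- move=> t _; have c1 : c t 0 0 = 1.
    by rewrite /c !mxE flat_head// flat_head//; lra.
  by split; rewrite ?c1// /model_form c1 sgr0 mul0r addr0 mulr1.
- move=> r t _ _; rewrite flat_dist /c !mxE.
  rewrite (_ : _ + _ = (r - t) ^+ 2 * (L ^+ 2 / L ^+ 2)).
    by rewrite divff ?mulr1 ?sqrtr_sqr// expf_neq0// gt_eqF.
  rewrite -{1}L2; field.
  by rewrite gt_eqF.
Qed.

(** Stewart's theorem computes the cevian of the Euclidean comparison triangle, placed with x' at
    the origin and y' on the first axis. *)
Lemma thin_flat x y z c1 c2 c3 t :
  geodesic_in d A x y c1 -> geodesic_in d A y z c2 -> geodesic_in d A z x c3 ->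
  0 < d x y -> 0 < d y z -> 0 < d z x ->
  ((d x y + d y z + d z x)%:E < 2%:E * @model_diam R 0)%E ->
  t \in `[0, d x y] ->
  d x y * d z (c1 t) ^+ 2 <= (d x y - t) * d z x ^+ 2 + t * d y z ^+ 2
    - t * (d x y - t) * d x y.
Proof.
move=> g1 g2 g3 xy0 yz0 zx0 per txy.
have t1 := metric_triangle z y x.
have t2 := metric_triangle y x z.
have t3 := metric_triangle x z y.
rewrite (metric_sym z y) (metric_sym y x) in t1.
rewrite (metric_sym y x) (metric_sym x z) in t2.
rewrite (metric_sym x z) (metric_sym z y) in t3.
set L := d x y in xy0 t1 t2 t3 txy *; set a := d z x in zx0 t1 t2 t3 *.
set b := d y z in yz0 t1 t2 t3 *.
pose p1 := (a ^+ 2 + L ^+ 2 - b ^+ 2) / (2 * L).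
have p1L : p1 * (2 * L) = a ^+ 2 + L ^+ 2 - b ^+ 2.
  by rewrite /p1 mulfVK// gt_eqF// mulr_gt0.
have p1a : p1 ^+ 2 <= a ^+ 2.
  rewrite -ler_sqrt ?sqr_ge0// !sqrtr_sqr (ger0_norm (ltW zx0)) ler_norml.
  by rewrite /p1 ler_pdivlMr ?mulr_gt0// ler_pdivrMr ?mulr_gt0//; nra.
pose p2 := Num.sqrt (a ^+ 2 - p1 ^+ 2).
have p2E : p2 ^+ 2 = a ^+ 2 - p1 ^+ 2 by rewrite sqr_sqrtr// subr_ge0.
pose x' : 'rV[R]_3 := row3 1 0 0; pose y' := row3 1 L 0; pose z' := row3 1 p1 p2.
have Mx p q : M (row3 1 p q).
  by split; rewrite ?row30// model_form_row3 sgr0; ring.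
have row1 p q : row3 1 p q 0 1 = p :> R by rewrite mxE.
have row2 p q : row3 1 p q 0 2%:R = q :> R by rewrite mxE.
have Dx p q p' q' l : 0 < l -> (p - p') ^+ 2 + (q - q') ^+ 2 = l ^+ 2 ->
    D (row3 1 p q) (row3 1 p' q') = l.
  by move=> l0; rewrite flat_dist !row1 !row2 => ->; rewrite sqrtr_sqr gtr0_norm.
have xy' : D x' y' = L by apply: Dx => //; ring.
have yz' : D y' z' = b by apply: Dx => //; rewrite sub0r sqrrN p2E; lra.
have zx' : D z' x' = a by apply: Dx => //; rewrite !subr0 p2E; ring.
have [|c1' g1' c1E] := @flat_geodesic x' y' (Mx _ _) (Mx _ _); first by rewrite xy'.
have [|c2' g2' _] := @flat_geodesic y' z' (Mx _ _) (Mx _ _); first by rewrite yz'.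
have [|c3' g3' _] := @flat_geodesic z' x' (Mx _ _) (Mx _ _); first by rewrite zx'.
have := thin_vertex thinA g1 g2 g3 per g1' g2' g3' xy' yz' zx' txy.
move=> h; have {h} : d z (c1 t) ^+ 2 <= D z' (c1' t) ^+ 2.
  by rewrite ler_sqr// nnegrE ?mdist_ge0// (le_trans (mdist_ge0 _ _) h).
rewrite c1E xy' flat_dist !mxE/= sqr_sqrtr ?addr_ge0 ?sqr_ge0//.
move=> h; apply: le_trans (ler_wpM2l (ltW xy0) h) _.
rewrite !mulr0 !addr0 !subr0 p2E !add0r.
rewrite (_ : L * _ = L * a ^+ 2 - p1 * (2 * L) * t + t ^+ 2 * L).
  by rewrite p1L; lra.
by field; rewrite gt_eqF.
Qed.

End FlatTriangles.

(** * Unique geodesics and convex distance functions in tiny balls *)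

Section ConvexBall.
Context {R : realType} {X : metricType R}.
Local Notation d := (@mdist R X).

(** What the later arguments retain of the CAT condition. Points of geodesics are described by
    distances instead of curves, so that the clauses apply to any point satisfying the equations,
    such as one obtained by prolonging a geodesic. *)
Record convex_ball (A : set X) : Prop := {
  cb_geod : forall y z, A y -> A z -> exists c, geodesic_in d A y z c;
  cb_uniq : forall y z m m', A y -> A z -> A m -> A m' ->
    d y m = d y m' -> d y m + d m z = d y z -> d y m' + d m' z = d y z ->
    m = m';
  cb_mid : forall q y z m, A q -> A y -> A z -> A m ->
    d y m = d m z -> d y m + d m z = d y z -> 2 * d q m <= d q y + d q z }.

Section CurvedMid.
Variables (kappa : R) (C S : R -> R) (b : R).
Hypothesis CS : curvature_trig kappa C S b.
Local Notation s := (Num.sg kappa).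

(** The left side is the sine addition formula, so the inequality says s * C 0 <= s * C h, and
    strict monotonicity leaves only h = 0. *)
Lemma curved_degenerate x y h : 0 < x -> 0 < y -> 0 <= h -> h <= b -> x + y < b ->
  s * (S y * C x + S x * C y) <= s * (S (x + y) * C h) -> h = 0.
Proof.
move=> x0 y0 h0 hb xyb; rewrite (_ : _ + _ = S (x + y)); last first.
  by rewrite (ct_SD CS); ring.
have Sxy : 0 < S (x + y) by apply: (ct_Sgt0 CS) => //; exact: addr_gt0.
apply: contraPP => /eqP hn0; have {}h0 : 0 < h by rewrite lt_def hn0.
have := ct_mono CS (lexx 0) h0 hb; rewrite (ct_0 CS).1 -(ltr_pM2l Sxy) mulr1.
by move=> sC; apply/negP; rewrite -ltNge; lra.
Qed.

(** Put u = (x + y) / 2 and w = (x - y) / 2. Then C x + C y = 2 C u C w and S L = 2 S (L / 2) C (L /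
    2). The triangle inequality gives |w| <= L / 2, so h > u would make both comparisons of cosines
    point the wrong way. *)
Lemma curved_mid x y L h : 0 <= x -> 0 <= y -> 0 < L -> x <= y + L -> y <= x + L ->
  x + y < b -> L < b -> h <= b ->
  s * (S (L / 2) * C x + S (L / 2) * C y) <= s * (S L * C h) -> 2 * h <= x + y.
Proof.
move=> x0 y0 L0 xyL yxL xyb Lb hb.
have SL2 : 0 < S (L / 2) by apply: (ct_Sgt0 CS); lra.
have CL2 : 0 < C (L / 2) by apply: (ct_Cgt0 CS); lra.
rewrite [X in S X * C h](_ : L = L / 2 + L / 2); last by field.
rewrite (ct_SD CS); move=> le1; rewrite leNgt; apply/negP => hu.
pose u := (x + y) / 2; pose w := (x - y) / 2.
have Ch : s * C h < s * C u by apply: (ct_mono CS) => //; rewrite /u; lra.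
have Cu : 0 < C u by apply: (ct_Cgt0 CS); rewrite /u; lra.
have Cw : s * C (L / 2) <= s * C w.
  rewrite -(ct_C_norm CS w); apply: (ct_mono_le CS) => //; last by lra.
  by rewrite /w ler_norml; apply/andP; split; lra.
have Cxy : C x + C y = 2 * C u * C w.
  rewrite (_ : x = u + w); last by rewrite /u /w; field.
  rewrite [in C y](_ : y = u - w); last by rewrite /u /w; field.
  by rewrite (ct_CD CS) (ct_CB CS); ring.
have : S (L / 2) * (2 * C u * (s * C (L / 2))) <= S (L / 2) * (2 * C u * (s * C w)).
  by rewrite ler_pM2l// ler_pM2l// mulr_gt0.
have : S (L / 2) * (2 * C (L / 2) * (s * C h)) < S (L / 2) * (2 * C (L / 2) * (s * C u)).
  by rewrite ltr_pM2l// ltr_pM2l// mulr_gt0.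
have : s * (S (L / 2) * C x + S (L / 2) * C y) = S (L / 2) * (s * (C x + C y)) by ring.
rewrite Cxy; lra.
Qed.

End CurvedMid.

Section TinyBall.
Variables (kappa : R) (x0 : X) (r0 : R).
Hypothesis tiny : tiny_ball kappa x0 r0.
Let A : set X := cball x0 (10 * r0).

Let r0_gt0 : 0 < r0. Proof. by case: tiny. Qed.
Let thinA : thin_triangles kappa A. Proof. by case: tiny => _ _ _ _ []. Qed.

Let diam_ge : ((100 * r0)%:E <= model_diam kappa)%E.
Proof.
have [_ _ + _ _] := tiny; case: model_diam => [m||].
- by rewrite -EFinM !lee_fin; lra.
- by rewrite leey.
- by rewrite gt0_muleNy.
Qed.

Let distA y z : A y -> A z -> d y z <= 20 * r0.
Proof.
rewrite /A /cball/= => yA zA; have := metric_triangle y x0 z.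
by rewrite (metric_sym y x0); lra.
Qed.

Let perA x y z : A x -> A y -> A z ->
  ((d x y + d y z + d z x)%:E < 2%:E * model_diam kappa)%E.
Proof.
move=> Ax Ay Az; have := diam_ge; have := distA Ax Ay; have := distA Ay Az.
have := distA Az Ax; case: model_diam => [m||] //.
- by rewrite -EFinM !lee_fin lte_fin; have := r0_gt0; lra.
- by move=> *; rewrite gt0_muley ?ltry.
Qed.

Let geodA y z : A y -> A z -> exists c, geodesic_in d A y z c.
Proof.
move=> Ay Az; have [_ _ _ _ [_ + _]] := tiny; apply => //.
apply: lt_le_trans diam_ge; rewrite lte_fin.
by have := distA Ay Az; have := r0_gt0; lra.
Qed.

Let curvature_cases : kappa = 0 \/ exists C S b,
  curvature_trig kappa C S b /\ 100 * r0 <= b.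
Proof.
have [k0|k0|->] := ltgtP kappa 0; last by left.
- right; exists (fun x => cosh (Num.sqrt (- kappa) * x)).
  exists (fun x => sinh (Num.sqrt (- kappa) * x)), (100 * r0).
  by split => //; exact: hyperbolic_trig.
- right; exists (fun x => cos (Num.sqrt kappa * x)).
  exists (fun x => sin (Num.sqrt kappa * x)), (pi / Num.sqrt kappa).
  split; first exact: spherical_trig.
  by rewrite -lee_fin (le_trans diam_ge)// model_diam_pos_le.
Qed.

(** Equality in the triangle inequality flattens the comparison triangle: its vertex falls on the
    opposite side, at the parameter in question. *)
Let degenerateA x y z c : A x -> A y -> A z -> geodesic_in d A x y c ->
  0 < d x z -> 0 < d z y -> d x z + d z y = d x y -> z = c (d x z).
Proof.
move=> Ax Ay Az g1 xz0 zy0 xyz; apply: mdist_positivity.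
have [c2 g2] := geodA Ay Az; have [c3 g3] := geodA Az Ax.
have per := perA Ax Ay Az.
have xy0 : 0 < d x y by rewrite -xyz addr_gt0.
have txy : d x z \in `[0, d x y] by rewrite in_itv/= ltW//= -xyz lerDl ltW.
have Ac : A (c (d x z)) by have [_ _ + _] := g1; exact.
have yz0 : 0 < d y z by rewrite metric_sym.
have zx0 : 0 < d z x by rewrite metric_sym.
have [[xyA zyA] zA] := (distA Ax Ay, distA Az Ay, distA Az Ac).
have [k0|[C [S [b [CS br0]]]]] := curvature_cases.
  move: thinA per; rewrite k0 => thin0 per.
  have := thin_flat thin0 g1 g2 g3 xy0 yz0 zx0 per txy.
  rewrite (metric_sym z x) (metric_sym y z) -xyz => le0.
  have : (d x z + d z y) * d z (c (d x z)) ^+ 2 <= 0 by apply: le_trans le0 _; lra.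
  rewrite xyz pmulr_rle0// => le1; apply/eqP.
  by rewrite -sqrf_eq0 eq_le le1 sqr_ge0.
have [rp h0] := (r0_gt0, mdist_ge0 z (c (d x z))).
apply: (curved_degenerate CS xz0 zy0 h0); [lra|lra|].
have := thin_curved thinA CS g1 g2 g3 xy0 yz0 zx0 _ _ per txy.
rewrite (metric_sym z x) (metric_sym y z) -xyz (addrC (d x z)) addrK.
by apply; lra.
Qed.

Let midA x y z c : A x -> A y -> A z -> geodesic_in d A x y c ->
  0 < d x y -> 0 < d y z -> 0 < d z x ->
  2 * d z (c (d x y / 2)) <= d z x + d z y.
Proof.
move=> Ax Ay Az g1 xy0 yz0 zx0.
have [c2 g2] := geodA Ay Az; have [c3 g3] := geodA Az Ax.
have per := perA Ax Ay Az.
have txy : d x y / 2 \in `[0, d x y] by rewrite in_itv/=; apply/andP; split; lra.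
have Ac : A (c (d x y / 2)) by have [_ _ + _] := g1; exact.
have t1 := metric_triangle z y x.
have t2 := metric_triangle y x z.
rewrite (metric_sym z y) (metric_sym y x) in t1.
rewrite (metric_sym y x) (metric_sym x z) in t2.
have [[[xyA yzA] zxA] zA] := (distA Ax Ay, distA Ay Az, distA Az Ax, distA Az Ac).
rewrite (metric_sym z y).
have [k0|[C [S [b [CS br0]]]]] := curvature_cases.
  move: thinA per; rewrite k0 => thin0 per.
  have := thin_flat thin0 g1 g2 g3 xy0 yz0 zx0 per txy.
  move: (d z (c _)) (mdist_ge0 z (c (d x y / 2))) => h h0 le1.
  rewrite -ler_sqr ?nnegrE; [|lra|lra].
  have : d x y * (4 * h ^+ 2) <= d x y * (d z x + d y z) ^+ 2.
    have : d x y * (d z x - d y z) ^+ 2 <= d x y * d x y ^+ 2.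
      by rewrite ler_pM2l//; nra.
    by lra.
  by rewrite ler_pM2l//; lra.
have := thin_curved thinA CS g1 g2 g3 xy0 yz0 zx0 _ _ per txy.
rewrite (_ : d x y - d x y / 2 = d x y / 2); last by field.
have rp := r0_gt0.
have lt1 : d x y + d z x < b by lra.
have lt2 : d y z < b by lra.
move=> /(_ lt1 lt2); apply: (curved_mid CS) => //; lra.
Qed.

Lemma tiny_ball_convex : convex_ball A.
Proof.
have uniq y z m m' : A y -> A z -> A m -> A m' ->
    d y m = d y m' -> d y m + d m z = d y z -> d y m' + d m' z = d y z -> m = m'.
  move=> Ay Az Am Am' ymm' ymz ym'z.
  have [ym0|ym0] := eqVneq y m.
    apply: mdist_positivity; rewrite -{1}ym0 -ymm' ym0; exact: mdistxx.
  have [mz0|mz0] := eqVneq m z.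
    apply/esym/mdist_positivity; move: ym'z; rewrite -ymm' mz0.
    by move/eqP; rewrite -subr_eq0 addrAC subrr add0r => /eqP.
  have [c g] := geodA Ay Az.
  rewrite (degenerateA Ay Az Am g) ?mdist_gt0//.
  rewrite (degenerateA Ay Az Am' g) ?ymm'// -?ymm' ?mdist_gt0//.
  rewrite -mdist_gt0 -(ltrD2l (d y m)) ymm' ym'z -ymz ymm' addr0.
  by rewrite ltrDl mdist_gt0.
split => // q y z m Aq Ay Az Am ym ymz.
have [c g] := geodA Ay Az.
have ymE : d y m = d y z / 2 by lra.
have mzE : d m z = d y z / 2 by lra.
have yz0 := mdist_ge0 y z.
have [c0 cL Ac ci] := g.
have I2 : d y z / 2 \in `[0, d y z] by rewrite in_itv/=; apply/andP; split; lra.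
have I0 : 0 \in `[0, d y z] by rewrite in_itv/= lexx.
have IL : d y z \in `[0, d y z] by rewrite in_itv/= lexx andbT.
have -> : m = c (d y z / 2).
  have yc : d y (c (d y z / 2)) = d y z / 2.
    rewrite -{1}c0 ci//= ?in_itv/= ?lexx ?yz0//.
    by rewrite sub0r normrN ger0_norm//; lra.
  have cz : d (c (d y z / 2)) z = d y z / 2.
    rewrite -{2}cL ci//= ?in_itv/= ?lexx ?yz0//.
    by rewrite ler0_norm; lra.
  apply: (uniq y z) => //; first exact: Ac.
    by rewrite yc.
  by rewrite yc cz; lra.
(* Comparison triangles were built with sides of positive length, so coinciding vertices are settled
   directly. *)
have [yz|yz] := eqVneq y z.
  by rewrite yz mdistxx mul0r c0 yz; lra.
have [<-|zq] := eqVneq z q.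
  rewrite mdistxx -{1}cL (ci _ _ IL I2) (metric_sym z y) ger0_norm; lra.
have [<-|yq] := eqVneq y q.
  rewrite mdistxx -{1}c0 (ci _ _ I0 I2) ler0_norm; lra.
by apply: midA; rewrite // mdist_gt0// eq_sym.
Qed.

End TinyBall.
End ConvexBall.

(** * Geodesics in a convex ball *)

Section Metric.
Context {R : realType} {X : metricType R}.
Local Notation d := (@mdist R X).

Lemma mdist_lip (x x' y y' : X) : `|d x y - d x' y'| <= d x x' + d y y'.
Proof.
have t1 := metric_triangle x x' y; have t2 := metric_triangle x' y' y.
have t3 := metric_triangle x' x y'; have t4 := metric_triangle x y y'.
rewrite (metric_sym x' x) in t3; rewrite (metric_sym y' y) in t2.
by rewrite ler_norml; apply/andP; split; lra.
Qed.

Lemma cvg_mdist {T : Type} (F : set_system T) (FF : Filter F) (f g : T -> X) y z :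
  f @ F --> y -> g @ F --> z -> d (f t) (g t) @[t --> F] --> d y z.
Proof.
move=> /metricType_numDomainType.cvgrPdist_lt fy.
move=> /metricType_numDomainType.cvgrPdist_lt gz.
apply/cvgrPdist_lt => e e0; have e2 : 0 < e / 2 by rewrite divr_gt0.
near=> t; have f1 : d y (f t) < e / 2 by near: t; exact: fy.
have g1 : d z (g t) < e / 2 by near: t; exact: gz.
by have := mdist_lip y (f t) z (g t); lra.
Unshelve. all: by end_near. Qed.

Definition clamp (t l : R) : R := Num.max 0 (Num.min t l).

Lemma clampE t l : 0 <= t -> t <= l -> clamp t l = t.
Proof. by move=> t0 tl; rewrite /clamp (min_idPl tl); exact/max_idPr. Qed.

Lemma clamp_itv t l : 0 <= l -> 0 <= clamp t l <= l.
Proof.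
move=> l0; rewrite /clamp le_max lexx/= ge_max l0/=.
by rewrite ge_min lexx orbT.
Qed.

Lemma cvg_clamp {T : Type} (F : set_system T) (FF : Filter F) (f g : T -> R) y z :
  f @ F --> y -> g @ F --> z -> clamp (f t) (g t) @[t --> F] --> clamp y z.
Proof.
move=> fy gz; rewrite /clamp maxr_absE minr_absE.
under eq_fun do rewrite maxr_absE minr_absE.
have m : (f t + g t - `|f t - g t|) / 2 @[t --> F] --> (y + z - `|y - z|) / 2.
  apply: cvgMl; apply: cvgB; first exact: cvgD.
  by apply: cvg_norm; exact: cvgB.
apply: cvgMl; apply: cvgD; first by apply: cvgD => //; exact: cvg_cst.
by apply: cvg_norm; apply: cvgB => //; exact: cvg_cst.
Qed.

Section Pt.
Variable A : set X.
Hypotheses (convA : convex_ball A) (compA : compact A).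

(** Equations between distances make this a closed condition jointly in [y], [z], [t] and [m]; the
    continuity of [pt] rests on it. *)
Definition on_segment y z t m :=
  [/\ A m, d y m = clamp t (d y z) & d m z = d y z - clamp t (d y z)].

(* Clamping t to [0, d y z] makes pt continuous in t on the whole line. *)
Definition pt y z t : X := xget y (on_segment y z t).

Section Endpoints.
Variables y z : X.
Hypotheses (Ay : A y) (Az : A z).

Lemma pt_segment t : on_segment y z t (pt y z t).
Proof.
have [c [c0 cL Ac ci]] := cb_geod convA Ay Az.
have /andP[t0 tl] := clamp_itv t (mdist_ge0 y z).
have I0 : 0 \in `[0, d y z] by rewrite in_itv/= lexx mdist_ge0.
have IL : d y z \in `[0, d y z] by rewrite in_itv/= lexx mdist_ge0.
have It : clamp t (d y z) \in `[0, d y z] by rewrite in_itv/= t0.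
apply: (xgetPex _ (ex_intro _ (c (clamp t (d y z))) _)); split.
- exact: Ac.
- by rewrite -{1}c0 (ci _ _ I0 It) sub0r normrN ger0_norm.
- by rewrite -{2}cL (ci _ _ It IL) ler0_norm ?subr_le0// opprB.
Qed.

Lemma pt_in t : A (pt y z t).
Proof. by case: (pt_segment t). Qed.

Lemma pt_uniq t m : A m -> d y m = t -> t + d m z = d y z -> pt y z t = m.
Proof.
move=> Am ym mz; have [Ap yp pz] := pt_segment t.
have tE : clamp t (d y z) = t.
  by rewrite clampE// -?ym ?mdist_ge0// -mz -ym lerDl mdist_ge0.
rewrite tE in yp pz; apply: (cb_uniq convA Ay Az) => //.
- by rewrite yp.
- by rewrite yp pz addrC subrK.
- by rewrite ym.
Qed.

Lemma pt_distl t : 0 <= t -> t <= d y z -> d y (pt y z t) = t.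
Proof. by move=> t0 tl; have [_ -> _] := pt_segment t; rewrite clampE. Qed.

Lemma pt_distr t : 0 <= t -> t <= d y z -> d (pt y z t) z = d y z - t.
Proof. by move=> t0 tl; have [_ _ ->] := pt_segment t; rewrite clampE. Qed.

Lemma pt0 : pt y z 0 = y.
Proof. by apply: pt_uniq => //; rewrite ?mdistxx// add0r. Qed.

Lemma pt1 : pt y z (d y z) = z.
Proof. by apply: pt_uniq => //; rewrite mdistxx addr0. Qed.

End Endpoints.

Lemma pt_sub y z t u : A y -> A z -> 0 <= t -> t <= u -> u <= d y z ->
  pt y (pt y z u) t = pt y z t.
Proof.
move=> Ay Az t0 tu uL; have u0 := le_trans t0 tu.
have Au := pt_in Ay Az u; have At := pt_in Ay Au t.
have yu := pt_distl Ay Az u0 uL; have uz := pt_distr Ay Az u0 uL.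
apply/esym/pt_uniq => //; first by rewrite pt_distl// yu.
have := pt_distr Ay Au t0; rewrite yu => /(_ tu) ptu.
have := metric_triangle (pt y (pt y z u) t) (pt y z u) z.
have := metric_triangle y (pt y (pt y z u) t) z.
by rewrite ptu uz pt_distl ?yu// => *; lra.
Qed.

Lemma pt_isometric y z : A y -> A z -> isometric_on d `[0, d y z] (pt y z).
Proof.
move=> Ay Az s t /=; wlog st : s t / s <= t.
  move=> W sI tI; have [st|/ltW ts] := leP s t; first exact: W.
  by rewrite metric_sym distrC; exact: W.
rewrite !in_itv/= => /andP[s0 sL] /andP[t0 tL].
rewrite ler0_norm ?subr_le0// opprB -(pt_sub Ay Az s0 st tL).
have At := pt_in Ay Az t; have yt := pt_distl Ay Az t0 tL.
by rewrite pt_distr ?yt.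
Qed.

Lemma geodesic_ptE y z c t : A y -> A z -> geodesic_in d A y z c ->
  t \in `[0, d y z] -> c t = pt y z t.
Proof.
move=> Ay Az [c0 cL Ac ci] tI; apply/esym.
have I0 : 0 \in `[0, d y z] by rewrite in_itv/= lexx mdist_ge0.
have IL : d y z \in `[0, d y z] by rewrite in_itv/= lexx mdist_ge0.
move: (tI); rewrite in_itv/= => /andP[t0 tL].
apply: pt_uniq => //; first exact: Ac.
  by rewrite -{1}c0 (ci _ _ I0 tI) sub0r normrN ger0_norm.
by rewrite -{1}cL (ci _ _ tI IL) ler0_norm ?subr_le0// opprB addrC subrK.
Qed.

(** A closed graph argument. By uniqueness, a point of [A] at distance at least e from the limit
    violates one of the two equations of [on_segment]. Violation is an open condition, so
    compactness makes it hold for all such points at once when the endpoints and the parameter are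
    close to their limits. *)
Lemma cvg_pt {T : Type} (F : set_system T) (FF : Filter F)
    (f g : T -> X) (h : T -> R) y z t :
  A y -> A z -> (\forall x \near F, A (f x)) -> (\forall x \near F, A (g x)) ->
  f @ F --> y -> g @ F --> z -> h @ F --> t ->
  pt (f x) (g x) (h x) @[x --> F] --> pt y z t.
Proof.
move=> Ay Az Af Ag fy gz ht; apply/metricType_numDomainType.cvgrPdist_lt => e e0.
pose K := A `&` [set m | e <= d (pt y z t) m].
have cK : compact K.
  apply: (subclosed_compact _ compA); last by move=> ? [].
  apply: closedI; first by apply: compact_closed => //; exact: metric_hausdorff.
  rewrite (_ : [set _ | _] = (d (pt y z t)) @^-1` [set r | e <= r])//.
  apply: closed_comp; last exact: closed_ge.
  by move=> m _; apply: cvg_mdist; [exact: cvg_cst|exact: cvg_id].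
have fst_cvg (m : X) : (fun q : X * T => q.1) @ filter_prod (nbhs m) F --> m.
  exact: cvg_fst.
have snd_cvg (m : X) (U : Type) (G : set_system U) (v : T -> U) : v @ F `=>` G ->
  (fun q : X * T => v q.2) @ filter_prod (nbhs m) F `=>` G.
  by move=> vG; apply: cvg_trans vG; apply: cvg_comp cvg_snd _.
have Ldyz : clamp (h x) (d (f x) (g x)) @[x --> F] --> clamp t (d y z).
  by apply: cvg_clamp => //; exact: cvg_mdist.
have FK : \forall x \near F, K `<=` (fun m => ~ on_segment (f x) (g x) (h x) m).
  move/compact_near_coveringP : cK; apply => // m [Am em].
  have [ym|ym] := eqVneq (d y m) (clamp t (d y z)).
    have mz : d m z + clamp t (d y z) != d y z.
      apply/eqP => mzE; move: em => /=; rewrite leNgt => /negP; apply.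
      have [Ap yp pz] := pt_segment Ay Az t.
      rewrite (_ : pt y z t = m) ?mdistxx//.
      by apply: (cb_uniq convA Ay Az) => //; rewrite ?yp ?pz// ?ym addrC ?subrK.
    have lim : (d q.1 (g q.2) + clamp (h q.2) (d (f q.2) (g q.2)) - d (f q.2) (g q.2))
        @[q --> filter_prod (nbhs m) F] --> d m z + clamp t (d y z) - d y z.
      apply: cvgB; last by apply: cvg_mdist; exact: snd_cvg.
      apply: cvgD; first by apply: cvg_mdist; [exact: fst_cvg|exact: snd_cvg].
      exact: (snd_cvg m _ _ _ Ldyz).
    have := cvgr_neq0 _ lim; rewrite subr_eq0 => /(_ _ mz).
    apply: filterS => -[m' x] /= /eqP ne [_ _ e2]; apply: ne.
    by rewrite e2 subrK subrr.
  have lim : (d (f q.2) q.1 - clamp (h q.2) (d (f q.2) (g q.2)))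
      @[q --> filter_prod (nbhs m) F] --> d y m - clamp t (d y z).
    apply: cvgB; first by apply: cvg_mdist; [exact: snd_cvg|exact: fst_cvg].
    exact: (snd_cvg m _ _ _ Ldyz).
  have := cvgr_neq0 _ lim; rewrite subr_eq0 => /(_ _ ym).
  apply: filterS => -[m' x] /= /eqP ne [_ e1 _]; apply: ne.
  by rewrite e1 subrr.
near=> x; rewrite ltNge; apply/negP => ed.
have sx : on_segment (f x) (g x) (h x) (pt (f x) (g x) (h x)).
  by apply: pt_segment; near: x.
have : K `<=` (fun m => ~ on_segment (f x) (g x) (h x) m) by near: x.
by move=> /(_ (pt (f x) (g x) (h x))); apply => //; split => //; case: sx.
Unshelve. all: by end_near. Qed.

(** Midpoint convexity plus continuity. At a maximum u of the deviation [phi] from the chord, the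
    midpoint inequality between the nearer end, where [phi] vanishes, and its mirror image in u
    gives 2 phi(u) <= phi(u). The factor d y z spares a division when y = z. *)
Lemma convex_dist q y z t : A q -> A y -> A z -> 0 <= t -> t <= d y z ->
  d y z * d q (pt y z t) <= (d y z - t) * d q y + t * d q z.
Proof.
move=> Aq Ay Az t0 tL; set L := d y z.
pose phi t := L * d q (pt y z t) - ((L - t) * d q y + t * d q z).
have L0 : 0 <= L by exact: mdist_ge0.
have cphi : continuous phi.
  move=> u; apply: cvgB.
    apply: cvgMr; apply: cvg_mdist; first exact: cvg_cst.
    by apply: cvg_pt => //; [exact: nearW|exact: nearW|exact: cvg_cst|exact: cvg_cst].
  apply: cvgD; apply: cvgMl => //.
  by apply: cvgB => //; exact: cvg_cst.
have [u] := EVT_max L0 (continuous_subspaceT cphi).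
rewrite in_itv/= => /andP[u0 uL] umax.
have phi0 : phi 0 = 0 by rewrite /phi pt0// subr0 mul0r addr0 subrr.
have phiL : phi L = 0 by rewrite /phi pt1// subrr mul0r add0r subrr.
have mid r s : 0 <= r -> r <= s -> s <= L -> 2 * phi ((r + s) / 2) <= phi r + phi s.
  move=> r0 rs sL; have iso := pt_isometric Ay Az.
  have Ir : r \in `[0, L] by rewrite in_itv/= r0 (le_trans rs).
  have Is : s \in `[0, L] by rewrite in_itv/= sL (le_trans r0).
  have Im : (r + s) / 2 \in `[0, L] by rewrite in_itv/=; apply/andP; split; lra.
  have := @cb_mid _ _ _ convA q (pt y z r) (pt y z s) (pt y z ((r + s) / 2)) Aq
    (pt_in Ay Az _) (pt_in Ay Az _) (pt_in Ay Az _).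
  rewrite (iso _ _ Ir Im) (iso _ _ Im Is) (iso _ _ Ir Is).
  rewrite !ler0_norm; try lra.
  have e1 : - (r - (r + s) / 2) = - ((r + s) / 2 - s) by field.
  have e2 : - (r - (r + s) / 2) + - ((r + s) / 2 - s) = - (r - s) by field.
  move=> /(_ e1 e2) h; have : L * (2 * d q (pt y z ((r + s) / 2))) <=
    L * (d q (pt y z r) + d q (pt y z s)) by exact: ler_wpM2l.
  by rewrite /phi; lra.
suff phiu : phi u <= 0.
  have := umax t; rewrite in_itv/= t0 tL => /(_ isT) tu.
  by rewrite -subr_le0; exact: le_trans tu phiu.
have [u2|u2] := leP u (L / 2).
  have := mid 0 (2 * u) (lexx _); rewrite add0r mulrC mulfK// phi0 add0r.
  have -> : (0 <= u * 2) = true by lra.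
  have -> : (u * 2 <= L) = true by lra.
  move=> /(_ isT isT); have := umax (u * 2); rewrite in_itv/=.
  have -> : (0 <= u * 2 <= L) = true by apply/andP; split; lra.
  by move=> /(_ isT); lra.
have := mid (2 * u - L) L; rewrite subrK mulrC mulfK// phiL addr0.
have -> : (0 <= u * 2 - L) = true by lra.
have -> : (u * 2 - L <= L) = true by lra.
move=> /(_ isT isT (lexx _)); have := umax (u * 2 - L); rewrite in_itv/=.
have -> : (0 <= u * 2 - L <= L) = true by apply/andP; split; lra.
by move=> /(_ isT); lra.
Unshelve. all: by end_near. Qed.

(** Difference quotients of a convex function increase; this is what carries a first order bound
    from the scale u to every smaller scale t. *)
Lemma convex_slope q y z t u : A q -> A y -> A z -> 0 <= t -> t <= u -> u <= d y z ->
  u * (d q (pt y z t) - d q y) <= t * (d q (pt y z u) - d q y).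
Proof.
move=> Aq Ay Az t0 tu uL; have u0 := le_trans t0 tu.
have := convex_dist Aq Ay (pt_in Ay Az u) t0.
by rewrite (pt_distl Ay Az u0 uL) => /(_ tu); rewrite pt_sub//; lra.
Qed.

End Pt.
End Metric.

(** * Angles and first variation *)

Section RealFacts.
Context {R : realType}.
Implicit Types x y a b : R.

Lemma sin_le_norm x : 0 <= x -> `|sin x| <= x.
Proof.
move=> x0.
have cs : {within `[0, x], continuous (@sin R)}.
  by apply: continuous_subspaceT; exact: continuous_sin.
have [c _] := @MVT_segment R (@sin R) (@cos R) 0 x x0 (fun y _ => is_derive_sin y) cs.
rewrite sin0 !subr0 => ->; rewrite normrM (ger0_norm x0).
by rewrite ler_piMl// cos_max.
Qed.

Lemma sin_norm_le x : `|sin x| <= `|x|.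
Proof.
have [x0|x0] := leP 0 x; first by rewrite (ger0_norm x0) sin_le_norm.
by rewrite -normrN -sinN -(normrN x) (ger0_norm (x := - x)) ?sin_le_norm ?oppr_ge0 ?ltW.
Qed.

Lemma cosB_half x y :
  cos x - cos y = - 2 * (sin ((x + y) / 2) * sin ((x - y) / 2)).
Proof.
have -> : cos x = cos ((x + y) / 2 + (x - y) / 2) by congr cos; field.
have -> : cos y = cos ((x + y) / 2 - (x - y) / 2) by congr cos; field.
by rewrite cosD cosB; ring.
Qed.

Lemma cosD_half x y :
  cos x + cos y = 2 * (cos ((x + y) / 2) * cos ((x - y) / 2)).
Proof.
have -> : cos x = cos ((x + y) / 2 + (x - y) / 2) by congr cos; field.
have -> : cos y = cos ((x + y) / 2 - (x - y) / 2) by congr cos; field.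
by rewrite cosD cosB; ring.
Qed.

Lemma cos_lip x y : `|cos x - cos y| <= `|x - y|.
Proof.
rewrite cosB_half normrM normrN normr_nat normrM.
have : `|sin ((x - y) / 2)| <= `|x - y| / 2.
  by apply: le_trans (sin_norm_le _) _; rewrite normrM (ger0_norm (x := 2^-1)).
have := sin_max ((x + y) / 2); have := normr_ge0 (sin ((x - y) / 2)).
move: `|sin _| `|sin _| => u v v0 u1 v1.
have := ler_wpM2r v0 u1; rewrite mul1r; lra.
Qed.

(** The sum formula gives -2 cos ((a + b) / 2) cos ((a - b) / 2), where the second cosine lies in
    [0, 1] and the first is at least -e / 2. The lemma turns an angle excess into a rate of change,
    for nearly opposite directions and, with b = pi / 2, for nearly orthogonal ones. *)
Lemma cosN_sum_le a b e : 0 <= a <= pi -> 0 <= b <= pi -> 0 <= e -> a + b <= pi + e ->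
  - cos a - cos b <= e.
Proof.
move=> /andP[a0 api] /andP[b0 bpi] e0 ab.
rewrite -opprD cosD_half.
have w0 : 0 <= cos ((a - b) / 2) by apply: cos_ge0_pihalf; apply/andP; split; lra.
have w1 := cos_le1 ((a - b) / 2).
have [u0|u0] := leP 0 (cos ((a + b) / 2)).
  by apply: le_trans e0; rewrite oppr_le0 mulr_ge0// mulr_ge0.
have abp : pi < a + b.
  rewrite ltNge; apply/negP => abp; move: u0; rewrite ltNge => /negP; apply.
  by apply: cos_ge0_pihalf; have := @pi_gt0 R; move=> *; apply/andP; split; lra.
have cE : - cos ((a + b) / 2) = sin ((a + b - pi) / 2).
  by rewrite -[RHS]opprK -cosDpihalf; congr (- cos _); field.
suff : sin ((a + b - pi) / 2) <= e / 2.
  rewrite -cE; move: (cos ((a - b) / 2)) (cos ((a + b) / 2)) w0 w1 u0.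
  by move=> w u w0 w1 u0 ue; nra.
by apply: le_trans (ler_norm _) _; apply: le_trans (sin_le_norm _) _; lra.
Qed.

Lemma near_right2P (P : R * R -> Prop) :
  (\forall st \near filter_prod 0^'+ 0^'+, P st) <->
  exists2 e : R, 0 < e &
    forall s t, 0 < s -> s < e -> 0 < t -> t < e -> P (s, t).
Proof.
split.
  move=> [[U V] /= [U0 V0] UV].
  case: U0 => e1 /= e10 U1; case: V0 => e2 /= e20 V1.
  exists (Num.min e1 e2); first by rewrite lt_min e10.
  move=> s t s0; rewrite !lt_min => /andP[s1 _] t0 /andP[_ t2].
  apply: UV; split => /=; [apply: U1|apply: V1] => //=.
    by rewrite /ball_/= sub0r normrN gtr0_norm.
  by rewrite /ball_/= sub0r normrN gtr0_norm.
move=> [e e0 H].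
have N : 0^'+ [set x | 0 < x /\ x < e].
  by near=> x; split => //; near: x; exact: nbhs_right_lt.
exists ([set x | 0 < x /\ x < e], [set x | 0 < x /\ x < e]) => //.
by move=> [s t] [[/= s0 se] [t0 te]]; exact: H.
Unshelve. all: by end_near. Qed.

Lemma near_rightP (P : R -> Prop) : (\forall t \near 0^'+, P t) <->
  exists2 e : R, 0 < e & forall t, 0 < t -> t < e -> P t.
Proof.
split.
  case=> e /= e0 H; exists e => // t t0 te; apply: H => //=.
  by rewrite /ball_/= sub0r normrN gtr0_norm.
move=> [e e0 H]; near=> t; apply: H => //; near: t; exact: nbhs_right_lt.
Unshelve. all: by end_near. Qed.

End RealFacts.

Section Angles.
Context {R : realType} {X : metricType R}.
Local Notation d := (@mdist R X).
Implicit Types (x : X) (c : R -> X) (s t : R).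

(** The cosine of the Euclidean comparison angle whose upper limit is [angle]. *)
Definition cmp_cos c c' s t : R :=
  (s ^+ 2 + t ^+ 2 - d (c s) (c' t) ^+ 2) / (2 * s * t).

Lemma cmp_cosE c c' s t : 0 < s -> 0 < t ->
  d (c s) (c' t) ^+ 2 = s ^+ 2 + t ^+ 2 - 2 * s * t * cmp_cos c c' s t.
Proof.
by move=> s0 t0; rewrite /cmp_cos; field; rewrite !gt_eqF.
Qed.

Lemma cmp_cosC c c' s t : cmp_cos c c' s t = cmp_cos c' c t s.
Proof.
by rewrite /cmp_cos metric_sym; congr (_ / _); ring.
Qed.

Definition ray x c l := c 0 = x /\ isometric_on d `[0, l] c.

Lemma ray_dist x c l t : ray x c l -> 0 <= t -> t <= l -> d x (c t) = t.
Proof.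
move=> [c0 ci] t0 tl; rewrite -c0 ci /= ?in_itv/= ?lexx ?t0 ?(le_trans t0)//.
by rewrite sub0r normrN ger0_norm.
Qed.

Lemma cmp_cos_itv x c c' l s t : ray x c l -> ray x c' l ->
  0 < s -> s <= l -> 0 < t -> t <= l -> -1 <= cmp_cos c c' s t <= 1.
Proof.
move=> rc rc' s0 sl t0 tl.
have ds := ray_dist rc (ltW s0) sl; have dt := ray_dist rc' (ltW t0) tl.
have st0 : 0 < 2 * s * t by rewrite !mulr_gt0.
have t1 := metric_triangle (c s) x (c' t).
have t2 := metric_triangle x (c s) (c' t); have t3 := metric_triangle x (c' t) (c s).
rewrite (metric_sym (c s) x) in t1; rewrite (metric_sym (c' t) (c s)) in t3.
rewrite /cmp_cos ler_pdivlMr// ler_pdivrMr// ds dt in t1 t2 t3 *.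
have := mdist_ge0 (c s) (c' t); move: (d _ _) t1 t2 t3 => u t1 t2 t3 u0.
by apply/andP; split; nra.
Qed.

Lemma geodesic_from_ray x c : geodesic_from x c -> exists2 l, 0 < l & ray x c l.
Proof. by move=> [c0 [l l0 ci]]; exists l. Qed.

Lemma ray_sub x c l l' : l' <= l -> ray x c l -> ray x c l'.
Proof.
move=> ll [c0 ci]; split => // s t /= sI tI; apply: ci => /=.
  by move: sI; rewrite !in_itv/= => /andP[-> /le_trans]; exact.
by move: tI; rewrite !in_itv/= => /andP[-> /le_trans]; exact.
Qed.

Lemma geodesic_from_ray2 x c c' : geodesic_from x c -> geodesic_from x c' ->
  exists l, [/\ 0 < l, ray x c l & ray x c' l].
Proof.
move=> /geodesic_from_ray[l l0 rc] /geodesic_from_ray[l' l'0 rc'].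
exists (Num.min l l'); split; first by rewrite lt_min l0.
  by apply: ray_sub rc; rewrite ge_min lexx.
by apply: ray_sub rc'; rewrite ge_min lexx orbT.
Qed.

(** Replaces the extended real limit superior by real inequalities: comparison angles lie in
    [0, pi], so it is finite, and it is the least bound valid up to any e near 0. *)
Lemma angleP x c c' : geodesic_from x c -> geodesic_from x c' ->
  [/\ 0 <= angle c c' <= pi,
    (forall e, 0 < e -> exists2 r, 0 < r &
       forall s t, 0 < s -> s < r -> 0 < t -> t < r ->
         acos (cmp_cos c c' s t) < angle c c' + e) &
    (forall a r, 0 < r -> (forall s t, 0 < s -> s < r -> 0 < t -> t < r ->
         acos (cmp_cos c c' s t) <= a) -> angle c c' <= a)].
Proof.
move=> gc gc'; have [l [l0 rc rc']] := geodesic_from_ray2 gc gc'.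
set F := filter_prod (0 : R)^'+ (0 : R)^'+.
pose f (st : R * R) := (acos (cmp_cos c c' st.1 st.2))%:E.
have -> : angle c c' = fine (limf_esup f F) by [].
have I s t : 0 < s -> s < l -> 0 < t -> t < l ->
    0 <= acos (cmp_cos c c' s t) <= pi.
  move=> s0 sl t0 tl.
  have H := cmp_cos_itv rc rc' s0 (ltW sl) t0 (ltW tl).
  by rewrite acos_ge0//= acos_lepi.
have PF : ProperFilter F by exact: filter_prod_proper.
have le_sup a r : 0 < r -> (forall s t, 0 < s -> s < r -> 0 < t -> t < r ->
    acos (cmp_cos c c' s t) <= a) -> (limf_esup f F <= a%:E)%E.
  move=> r0 H; apply: ereal_inf_le => /=.
  exists (ereal_sup (f @` [set st | 0 < st.1 < r /\ 0 < st.2 < r])).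
    exists [set st | 0 < st.1 < r /\ 0 < st.2 < r] => //.
    apply/near_right2P; exists r => // s t s0 sr t0 tr /=.
    by rewrite s0 sr t0 tr.
  apply: ge_ereal_sup => _ [[s t] [/andP[s0 sr] /andP[t0 tr]] <-].
  by rewrite lee_fin; exact: H.
have sup_pi : (limf_esup f F <= pi%:E)%E.
  by apply: (le_sup _ l l0) => s t s0 sl t0 tl; have /andP[] := I s t s0 sl t0 tl.
have sup_0 : (0 <= limf_esup f F)%E.
  apply: le_ereal_inf_tmp => _ [V FV <-].
  have : F (V `&` [set st | 0 < st.1 < l /\ 0 < st.2 < l]).
    apply: filterI => //; apply/near_right2P; exists l => // s t s0 sr t0 tr /=.
    by rewrite s0 sr t0 tr.
  move=> /filter_ex[[s t] [Vst [/= /andP[s0 sl] /andP[t0 tl]]]].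
  apply: le_ereal_sup_tmp; exists (f (s, t)); first by exists (s, t).
  by rewrite lee_fin; have /andP[] := I s t s0 sl t0 tl.
have fin : limf_esup f F \is a fin_num.
  by apply/fin_numPlt; rewrite (lt_le_trans _ sup_0) ?ltNy0//= (le_lt_trans sup_pi) ?ltry.
split.
- by rewrite -!lee_fin fineK// sup_0.
- move=> e e0; have : (limf_esup f F < (fine (limf_esup f F) + e)%:E)%E.
    by rewrite EFinD fineK// lteDl// lte_fin.
  move=> /ereal_inf_lt[_ [V FV <-] supV].
  have /near_right2P[r r0 H] := FV; exists r => // s t s0 sr t0 tr.
  rewrite -lte_fin; apply: le_lt_trans supV.
  by apply: le_ereal_sup_tmp; exists (f (s, t)) => //; exists (s, t) => //; exact: H.
- by move=> a r r0 H; rewrite -lee_fin fineK//; exact: le_sup r0 H.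
Qed.

Section Rays.
Variable x : X.

Lemma angle_ge0 c c' : geodesic_from x c -> geodesic_from x c' -> 0 <= angle c c'.
Proof. by move=> gc gc'; have [/andP[]] := angleP gc gc'. Qed.

Lemma angle_le_pi c c' : geodesic_from x c -> geodesic_from x c' -> angle c c' <= pi.
Proof. by move=> gc gc'; have [/andP[]] := angleP gc gc'. Qed.

Lemma angle_sym c c' : geodesic_from x c -> geodesic_from x c' ->
  angle c c' = angle c' c.
Proof.
suff H c1 c2 : geodesic_from x c1 -> geodesic_from x c2 -> angle c1 c2 <= angle c2 c1.
  by move=> gc gc'; apply/eqP; rewrite eq_le !H.
move=> g1 g2; have [_ _ H1] := angleP g1 g2; have [_ H2 _] := angleP g2 g1.
apply/ler_addgt0Pr => e e0; have [r r0 {}H2] := H2 e e0.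
by apply: (H1 _ r) => // s t s0 sr t0 tr; rewrite cmp_cosC ltW// H2.
Qed.

Lemma angle_refl c : geodesic_from x c -> angle c c = 0.
Proof.
move=> gc; have [/andP[a0 _] _ H] := angleP gc gc.
apply/eqP; rewrite eq_le a0 andbT.
have [l l0 [c0 ci]] := geodesic_from_ray gc.
apply: (H _ l l0) => s t s0 sl t0 tl.
rewrite /cmp_cos ci /= ?in_itv/= ?(ltW s0) ?(ltW t0) ?(ltW sl) ?(ltW tl)//.
rewrite real_normK ?num_real// (_ : _ / _ = 1) ?acos1//.
by field; rewrite !gt_eqF.
Qed.

(* If the angles add up to less than pi, cut the Euclidean triangle with sides
   s, u and angle a + b by the ray at angle a; its cevian has length t. *)
Lemma cevian a b s u : 0 < a -> 0 < b -> a + b < pi -> 0 < s -> 0 < u ->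
  exists t nu, [/\ 0 < t, t <= Num.max s u, 0 <= nu <= 1,
    s ^+ 2 + t ^+ 2 - 2 * s * t * cos a =
      (1 - nu) ^+ 2 * (s ^+ 2 + u ^+ 2 - 2 * s * u * cos (a + b)) &
    t ^+ 2 + u ^+ 2 - 2 * t * u * cos b =
      nu ^+ 2 * (s ^+ 2 + u ^+ 2 - 2 * s * u * cos (a + b))].
Proof.
move=> a0 b0 ab s0 u0.
have sa : 0 < sin a by apply: sin_gt0_pi; apply/andP; split; lra.
have sb : 0 < sin b by apply: sin_gt0_pi; apply/andP; split; lra.
have sab : 0 < sin (a + b) by apply: sin_gt0_pi; apply/andP; split; lra.
have D0 : 0 < s * sin a + u * sin b by rewrite addr_gt0// mulr_gt0.
have Dn : s * sin a + u * sin b != 0 by rewrite gt_eqF.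
(* The cevian divides the opposite side in the ratio s sin a : u sin b of the areas on its two
   sides. *)
pose nu := u * sin b / (s * sin a + u * sin b).
have nu0 : 0 <= nu by rewrite divr_ge0// ltW// mulr_gt0.
have nu1 : nu <= 1.
  by rewrite ler_pdivrMr// mul1r lerDr ltW// mulr_gt0.
have tE : nu * s * cos a + (1 - nu) * u * cos b =
    s * u * sin (a + b) / (s * sin a + u * sin b).
  by rewrite /nu sinD; field.
have sa2 := cos2Dsin2 a; have sb2 := cos2Dsin2 b.
exists (nu * s * cos a + (1 - nu) * u * cos b), nu.
have y0 : nu * s * sin a = (1 - nu) * u * sin b by rewrite /nu; field.
rewrite nu0 nu1; split => //.
- by rewrite tE divr_gt0// !mulr_gt0.
- have ca := cos_le1 a; have cb := cos_le1 b.
  have : nu * s * cos a <= nu * Num.max s u.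
    rewrite -mulrA; apply: ler_wpM2l => //.
    by apply: (@le_trans _ _ s); rewrite ?le_max ?lexx// ger_pMr.
  have : (1 - nu) * u * cos b <= (1 - nu) * Num.max s u.
    rewrite -mulrA; apply: ler_wpM2l; first by rewrite subr_ge0.
    by apply: (@le_trans _ _ u); rewrite ?le_max ?lexx ?orbT// ger_pMr.
  by lra.
- rewrite cosD; move: (cos a) (sin a) (cos b) (sin b) sa2 sb2 y0.
  move=> ca sa' cb sb' h1 h2 y0.
  have : s ^+ 2 * ca ^+ 2 = s ^+ 2 * (1 - sa' ^+ 2) by rewrite -h1; ring.
  have : (1 - nu) ^+ 2 * u ^+ 2 * (cb ^+ 2 + sb' ^+ 2) = (1 - nu) ^+ 2 * u ^+ 2.
    by rewrite h2 mulr1.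
  have : (1 - nu) ^+ 2 * s ^+ 2 * (ca ^+ 2 + sa' ^+ 2) = (1 - nu) ^+ 2 * s ^+ 2.
    by rewrite h1 mulr1.
  have : s ^+ 2 * (ca ^+ 2 + sa' ^+ 2) = s ^+ 2 by rewrite h1 mulr1.
  have : (s * sa' - (nu * s * sa' - (1 - nu) * u * sb')) ^+ 2 = (s * sa') ^+ 2.
    by rewrite y0 subrr subr0.
  by move=> *; lra.
- rewrite cosD; move: (cos a) (sin a) (cos b) (sin b) sa2 sb2 y0.
  move=> ca sa' cb sb' h1 h2 y0.
  have : nu ^+ 2 * u ^+ 2 * (cb ^+ 2 + sb' ^+ 2) = nu ^+ 2 * u ^+ 2.
    by rewrite h2 mulr1.
  have : nu ^+ 2 * s ^+ 2 * (ca ^+ 2 + sa' ^+ 2) = nu ^+ 2 * s ^+ 2.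
    by rewrite h1 mulr1.
  have : u ^+ 2 * (cb ^+ 2 + sb' ^+ 2) = u ^+ 2 by rewrite h2 mulr1.
  have : (u * sb' + (nu * s * sa' - (1 - nu) * u * sb')) ^+ 2 = (u * sb') ^+ 2.
    by rewrite y0 subrr addr0.
  by move=> *; lra.
Qed.

(** Below pi, both angles are enlarged by a small e. The cevian provides a point of the middle ray
    whose comparison distances to the outer two points add up to the third side of a Euclidean
    triangle with angle a + b, which therefore bounds the distance between these points. *)
Lemma angle_triangle c1 c2 c3 :
  geodesic_from x c1 -> geodesic_from x c2 -> geodesic_from x c3 ->
  angle c1 c3 <= angle c1 c2 + angle c2 c3.
Proof.
move=> g1 g2 g3; have [/andP[a0 api] H12 _] := angleP g1 g2.
have [/andP[b0 bpi] H23 _] := angleP g2 g3.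
have [/andP[_ gpi] _ H13] := angleP g1 g3.
have [//|ab] := leP pi (angle c1 c2 + angle c2 c3); first exact: le_trans.
apply/ler_addgt0Pr => e0 e00.
(* The first bound keeps the total error 2 e below e0, the second keeps the enlarged angles below pi
   in sum. *)
pose e := Num.min (e0 / 2) ((pi - (angle c1 c2 + angle c2 c3)) / 4).
have e_gt0 : 0 < e by rewrite lt_min !divr_gt0// subr_gt0.
have e1 : e <= e0 / 2 by rewrite ge_min lexx.
have e2 : e <= (pi - (angle c1 c2 + angle c2 c3)) / 4 by rewrite ge_min lexx orbT.
have [r1 r10 {}H12] := H12 e e_gt0; have [r2 r20 {}H23] := H23 e e_gt0.
have [l1 [l10 ra1 ra2]] := geodesic_from_ray2 g1 g2.
have [l2 [l20 ra2' ra3]] := geodesic_from_ray2 g2 g3.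
pose r := Num.min (Num.min r1 r2) (Num.min l1 l2).
have r0 : 0 < r by rewrite !lt_min r10 r20 l10.
apply: (H13 _ r r0) => s u s0 sr u0 ur.
pose a := angle c1 c2 + e; pose b := angle c2 c3 + e.
have [|||||t [nu [t0 tsu /andP[nu0 nu1] E1 E2]]] := @cevian a b s u.
all: rewrite /a /b; try lra.
have tr : t < r by apply: le_lt_trans tsu _; rewrite gt_max sr.
move: sr ur tr; rewrite !lt_min => /andP[/andP[s1 s2] /andP[s3 s4]].
move=> /andP[/andP[u1 u2] /andP[u3 u4]] /andP[/andP[t1 t2] /andP[t3 t4]].
have I12 := cmp_cos_itv ra1 ra2 s0 (ltW s3) t0 (ltW t3).
have I23 := cmp_cos_itv ra2' ra3 t0 (ltW t4) u0 (ltW u4).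
have ra3' : ray x c3 (Num.min l1 l2) by apply: ray_sub ra3; rewrite ge_min lexx orbT.
have ra1' : ray x c1 (Num.min l1 l2) by apply: ray_sub ra1; rewrite ge_min lexx.
have I13 : -1 <= cmp_cos c1 c3 s u <= 1.
  by apply: cmp_cos_itv ra1' ra3' s0 _ u0 _; rewrite le_min !ltW.
have cos12 : cos a <= cmp_cos c1 c2 s t.
  rewrite -[leRHS]acosK ?in_itv//= leNgt ltr_cos ?in_itv/= ?acos_ge0 ?acos_lepi//.
    by rewrite -leNgt ltW// H12.
  by apply/andP; split; rewrite /a; lra.
have cos23 : cos b <= cmp_cos c2 c3 t u.
  rewrite -[leRHS]acosK ?in_itv//= leNgt ltr_cos ?in_itv/= ?acos_ge0 ?acos_lepi//.
    by rewrite -leNgt ltW// H23.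
  by apply/andP; split; rewrite /b; lra.
pose D2 := s ^+ 2 + u ^+ 2 - 2 * s * u * cos (a + b).
have D20 : 0 <= D2.
  have : 2 * s * u * cos (a + b) <= 2 * s * u.
    by rewrite ger_pMr ?cos_le1// !mulr_gt0.
  by have := sqr_ge0 (s - u); rewrite /D2; lra.
pose D := Num.sqrt D2.
have D_ge0 : 0 <= D by exact: sqrtr_ge0.
have DD : D ^+ 2 = D2 by rewrite sqr_sqrtr.
have d12 : d (c1 s) (c2 t) <= (1 - nu) * D.
  rewrite -ler_sqr ?nnegrE ?mdist_ge0 ?mulr_ge0 ?subr_ge0//.
  rewrite exprMn DD /D2 -E1 cmp_cosE// lerD2l lerN2.
  by rewrite ler_pM2l// !mulr_gt0.
have d23 : d (c2 t) (c3 u) <= nu * D.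
  rewrite -ler_sqr ?nnegrE ?mdist_ge0 ?mulr_ge0//.
  rewrite exprMn DD /D2 -E2 cmp_cosE// lerD2l lerN2.
  by rewrite ler_pM2l// !mulr_gt0.
have d13 : d (c1 s) (c3 u) <= D.
  by apply: le_trans (metric_triangle _ (c2 t) _) _; lra.
have : cos (a + b) <= cmp_cos c1 c3 s u.
  have : d (c1 s) (c3 u) ^+ 2 <= D ^+ 2 by rewrite ler_sqr ?nnegrE ?mdist_ge0.
  rewrite DD /D2 cmp_cosE// lerD2l lerN2.
  by rewrite ler_pM2l// !mulr_gt0.
move=> cosab; apply: (@le_trans _ _ (a + b)); last by rewrite /a /b; lra.
move: cosab; rewrite -[leRHS]acosK ?in_itv//= leNgt ltr_cos ?in_itv/=.
- by rewrite -leNgt.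
- by apply/andP; split; rewrite /a /b; lra.
- by rewrite acos_ge0 ?acos_lepi.
Qed.

(** The triangle inequality through a point [c s] close to x reduces the claim to small triangles,
    where the comparison angle exceeds the angle by less than e / 2. For s fixed, completing the
    square leaves an error quadratic in t. *)
Lemma first_variation c w l e : ray x c l -> 0 < l -> geodesic_from x w -> 0 < e ->
  \forall t \near (0 : R)^'+, d (c l) (w t) <= l + t * (e - cos (angle c w)).
Proof.
move=> rc l0 gw e0.
have gc : geodesic_from x c by case: rc => c0 ci; split => //; exists l.
have [_ H _] := angleP gc gw; have e2 : 0 < e / 2 by rewrite divr_gt0.
have [r r0 {}H] := H _ e2.
have [l' l'0 rw] := geodesic_from_ray gw.
pose m := Num.min r (Num.min l l'); have m0 : 0 < m by rewrite !lt_min r0 l0.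
have [mr ml ml'] : [/\ m <= r, m <= l & m <= l'].
  by split; rewrite !ge_min lexx ?orbT.
pose s := m / 2; have s0 : 0 < s by rewrite divr_gt0.
have sm : s < m by rewrite /s; lra.
(* For t < s * e the quadratic error t^2 / (2 s) is at most t * e / 2. *)
apply/near_rightP; exists (Num.min s (s * e)); first by rewrite lt_min s0 mulr_gt0.
move=> t t0; rewrite lt_min => /andP[ts tse].
set al := angle c w.
have sl : s <= l by lra.
have I := cmp_cos_itv (ray_sub ml rc) (ray_sub ml' rw) s0 (ltW sm) t0 (ltW (lt_trans ts sm)).
have cosg : cos al - e / 2 <= cmp_cos c w s t.
  set k := cmp_cos c w s t; rewrite -[leRHS]acosK ?in_itv//=.
  have [le_al|lt_al] := leP (acos k) al.
    apply: (@le_trans _ _ (cos al)); first by lra.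
    rewrite leNgt ltr_cos ?in_itv/= ?acos_ge0 ?acos_lepi ?angle_ge0 ?angle_le_pi//.
    by rewrite -leNgt.
  have : acos k < al + e / 2 by apply: H => //; lra.
  move=> lt2; have := le_trans (ler_norm _) (cos_lip al (acos k)).
  by rewrite ler0_norm; lra.
have cs : d (c l) (c s) = l - s.
  case: rc => _ ci; rewrite ci /= ?in_itv/= ?lexx ?(ltW l0) ?(ltW s0)//.
  by rewrite ger0_norm; lra.
have dsw : d (c s) (w t) <= s + (t ^+ 2 / (2 * s) - t * (cos al - e / 2)).
  have cal := cos_le1 al.
  have ts2 : 0 <= t ^+ 2 / (2 * s).
    by rewrite divr_ge0 ?sqr_ge0// mulr_ge0// ltW.
  have q0 : t * (cos al - e / 2) <= t by rewrite ger_pMr//; lra.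
  rewrite -ler_sqr ?nnegrE ?mdist_ge0//; last by lra.
  rewrite cmp_cosE//.
  have : 2 * s * t * (cos al - e / 2) <= 2 * s * t * cmp_cos c w s t.
    by rewrite ler_pM2l// !mulr_gt0.
  have : 2 * s * (t ^+ 2 / (2 * s)) = t ^+ 2.
    by field; rewrite gt_eqF.
  have := sqr_ge0 (t ^+ 2 / (2 * s) - t * (cos al - e / 2)).
  by move: (t ^+ 2 / (2 * s)) => A; lra.
have : t ^+ 2 / (2 * s) <= t * (e / 2).
  rewrite ler_pdivrMr ?mulr_gt0// (_ : t * (e / 2) * (2 * s) = t * (s * e)); last by field.
  by rewrite expr2 ler_pM2l// ltW.
have := metric_triangle (c l) (c s) (w t); rewrite cs; lra.
Qed.

End Rays.
End Angles.

(** * From the completed space of directions back to geodesics *)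

Section Directions.
Context {R : realType} {X : metricType R}.
Local Notation d := (@mdist R X).
Variable x : X.

Lemma directions_cst c : geodesic_from x c -> directions x (fun=> c).
Proof.
move=> gc; split => // e e0; exists 0%N => m n _ _.
by rewrite (angle_refl gc).
Qed.

Section Pair.
Variables v w : nat -> R -> X.
Hypotheses (dv : directions x v) (dw : directions x w).

Let gv n : geodesic_from x (v n). Proof. by case: dv. Qed.
Let gw n : geodesic_from x (w n). Proof. by case: dw. Qed.

Let angle_le m n : angle (v m) (w m) <=
  angle (v m) (v n) + angle (v n) (w n) + angle (w n) (w m).
Proof.
have := angle_triangle (gv m) (gv n) (gw m).
by have := angle_triangle (gv n) (gw n) (gw m); lra.
Qed.

Lemma cvg_dir_dist : angle (v n) (w n) @[n --> \oo] --> dir_dist v w.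
Proof.
apply: R_complete; apply: cauchy_exP => e e0.
have e2 : 0 < e / 2 by rewrite divr_gt0.
have [Nv Hv] := dv.2 _ e2; have [Nw Hw] := dw.2 _ e2.
pose N := maxn Nv Nw.
exists (angle (v N) (w N)); exists N => // n /= Nn.
have [vN wN] : (Nv <= N)%N /\ (Nw <= N)%N by rewrite /N !leq_max !leqnn orbT.
have [vn wn] := (leq_trans vN Nn, leq_trans wN Nn).
rewrite /ball/= /ball_/=.
have := angle_le N n; have := angle_le n N.
have := Hv _ _ vN vn; have := Hv _ _ vn vN.
have := Hw _ _ wN wn; have := Hw _ _ wn wN.
by rewrite ltr_norml => *; apply/andP; split; lra.
Qed.

Lemma angle_le_dir_dist N e :
  (forall m n, (N <= m)%N -> (N <= n)%N -> angle (v m) (v n) < e) ->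
  (forall m n, (N <= m)%N -> (N <= n)%N -> angle (w m) (w n) < e) ->
  angle (v N) (w N) <= dir_dist v w + 2 * e.
Proof.
move=> Hv Hw; rewrite -lerBlDr.
apply: limr_ge; first exact: cvg_dir_dist.
exists N => // n /= Nn.
have := angle_le N n; have := Hv _ _ (leqnn N) Nn; have := Hw _ _ Nn (leqnn N).
by lra.
Qed.

End Pair.

(** Opposite directions live in the completion and need not be represented by geodesics; a common
    late term of their Cauchy sequences is a geodesic and costs at most e in each angle. *)
Lemma opposite_geodesics k (delta e : R) (g : 'I_k -> R -> X) :
  spherical_tuple x delta (fun i => fun=> g i) -> (forall i, geodesic_from x (g i)) ->
  0 < e -> exists c : 'I_k -> R -> X,
  [/\ forall i, geodesic_from x (c i),
      forall i w, geodesic_from x w -> angle (g i) w + angle w (c i) <= pi + delta + e &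
      forall i j, i != j -> [/\ angle (g i) (c j) <= pi / 2 + delta + e,
        angle (g i) (g j) <= pi / 2 + delta + e &
        angle (c i) (c j) <= pi / 2 + delta + e]].
Proof.
move=> [v [opp off]] gg e0; have e2 : 0 < e / 2 by rewrite divr_gt0.
have dv i : directions x (v i) by have [] := opp i.
have : \forall N \near \oo, forall i m n, (N <= m)%N -> (N <= n)%N ->
    angle (v i m) (v i n) < e / 2.
  apply: filter_forall => i; have [N H] := (dv i).2 _ e2.
  exists N => // M /= NM m n Mm Mn.
  by apply: H; [exact: leq_trans Mm|exact: leq_trans Mn].
case=> N _ /(_ N (leqnn N)) vN.
have dg i := directions_cst (gg i).
have cst (c : R -> X) : geodesic_from x c ->
    forall m n, (N <= m)%N -> (N <= n)%N -> angle c c < e / 2.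
  by move=> gc m n _ _; rewrite (angle_refl gc).
exists (fun i => v i N); split.
- by move=> i; case: (dv i).
- move=> i w gw; have [_ _ /(_ _ (directions_cst gw))] := opp i.
  have := angle_le_dir_dist (directions_cst gw) (dv i) (cst _ gw) (vN i).
  have -> : dir_dist (fun=> g i) (fun=> w) = angle (g i) w by exact: (lim_cst (@Rhausdorff R)).
  by lra.
- move=> i j ij; have [h1 h2 h3] := off i j ij.
  have half (a b : R) : b < pi / 2 + delta -> a <= b + 2 * (e / 2) ->
    a <= pi / 2 + delta + e by clear; lra.
  split.
  - exact: half h1 (angle_le_dir_dist (dg i) (dv j) (cst _ (gg i)) (vN j)).
  - exact: half h2 (angle_le_dir_dist (dg i) (dg j) (cst _ (gg i)) (cst _ (gg j))).
  - exact: half h3 (angle_le_dir_dist (dv i) (dv j) (vN i) (vN j)).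
Qed.

End Directions.

(** * Charts adapted to a strainer *)

Section Extension.
Context {R : realType} {X : metricType R}.
Local Notation d := (@mdist R X).
Variable A : set X.
Hypotheses (convA : convex_ball A) (compA : compact A).
Hypothesis lgc : @locally_geodesically_complete R X.

Lemma closed_dist_le (f g : X -> R) : continuous f -> continuous g ->
  closed [set e | f e <= g e].
Proof.
move=> cf cg; rewrite (_ : [set e | _] = (fun e => g e - f e) @^-1` [set r | 0 <= r]).
  apply: closed_comp; last exact: closed_ge.
  by move=> e _; apply: cvgB; [exact: cg|exact: cf].
by apply/seteqP; split => e /=; rewrite subr_ge0.
Qed.

Lemma continuous_dist y : continuous (d y).
Proof. by move=> e; apply: cvg_mdist; [exact: cvg_cst|exact: cvg_id]. Qed.

(* A maximally long extension exists by compactness; local geodesic completeness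
   prolongs it by some s, and convexity of the distance to z along the prolonged
   end makes the prolongation a geodesic again. *)
Lemma geodesic_extension z y l : A y -> z != y -> d z y <= l -> cball z l `<=` A ->
  exists e, [/\ A e, d z e = l & pt A z e (d z y) = y].
Proof.
move=> Ay zy yl zA; have Az : A z.
  by apply: zA; rewrite /cball/= mdistxx (le_trans (mdist_ge0 _ _) yl).
have zy0 : 0 < d z y by rewrite mdist_gt0.
pose E := A `&` [set e | d z e <= l] `&` [set e | d z y + d y e <= d z e].
have cE : compact E.
  apply: (subclosed_compact _ compA); last by move=> e [[]].
  apply: closedI; first apply: closedI.
  - by apply: compact_closed => //; exact: metric_hausdorff.
  - by apply: closed_dist_le; [exact: continuous_dist|move=> e; exact: cvg_cst].
  - apply: closed_dist_le; last exact: continuous_dist.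
    by move=> e; apply: cvgD; [exact: cvg_cst|exact: continuous_dist].
have E0 : E !=set0 by exists y; split => //=; rewrite mdistxx addr0.
have cz : continuous (d z) by exact: continuous_dist.
have [e] := compact_EVT_max E0 cE (continuous_subspaceT cz).
rewrite inE => -[[Ae /= el] ze] emax.
have tri u := metric_triangle z y u.
have zye : d z y + d y e = d z e by apply/eqP; rewrite eq_le ze tri.
have yze : d z y <= d z e by rewrite -zye lerDl mdist_ge0.
suff Le : d z e = l.
  by exists e; split => //; apply: pt_uniq.
apply/eqP; rewrite eq_le el/= leNgt; apply/negP => Ll.
set L := d z e in Ll zye yze el.
have L0 : 0 < L by exact: lt_le_trans yze.
pose c := pt A z e.
have iso : isometric_on d `[0, L] c by exact: pt_isometric.
have lc : local_geodesic d 0 L c.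
  by move=> t tI; exists 1 => // s u [sI _] [uI _]; exact: iso.
have [e1 e10 [c' lc' cc']] := lgc L0 lc.
have LI : L \in `[0 - e1, L + e1] by rewrite in_itv/=; apply/andP; split; lra.
have [e2 e20 iso'] := lc' L LI.
(* The four bounds keep L + s in the domain of [c'], both parameters in the interval where [c'] is
   isometric, L - s nonnegative, and the new endpoint within l of z. *)
pose s := Num.min (Num.min e1 (e2 / 2)) (Num.min L (l - L)).
have s0 : 0 < s by rewrite !lt_min e10 divr_gt0//= L0 subr_gt0.
have [se1 se2 sL sl] : [/\ s <= e1, s <= e2 / 2, s <= L & s <= l - L].
  by split; rewrite /s !ge_min lexx ?orbT.
have inI t : `|t - L| <= s -> (`[0 - e1, L + e1] `&` ball L e2) t.
  move=> ts; split.
    move: ts; rewrite ler_norml /= in_itv/= => /andP[ts1 ts2].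
    by apply/andP; split; lra.
  rewrite /ball/= distrC; apply: le_lt_trans ts _; lra.
have [IL Im Ie] : [/\ (`[0 - e1, L + e1] `&` ball L e2) L,
    (`[0 - e1, L + e1] `&` ball L e2) (L - s) &
    (`[0 - e1, L + e1] `&` ball L e2) (L + s)].
  split; apply: inI; first by rewrite subrr normr0 ltW.
    by rewrite addrAC subrr sub0r normrN gtr0_norm.
  by rewrite addrAC subrr add0r gtr0_norm.
have cL : c' L = e by rewrite cc' ?in_itv/= ?lexx ?ltW// /c pt1.
have cm : c' (L - s) = c (L - s) by rewrite cc'// in_itv/=; apply/andP; split; lra.
have Am : A (c (L - s)) by exact: pt_in.
have zm : d z (c (L - s)) = L - s by rewrite pt_distl//; lra.
have me : d (c (L - s)) e = s.
  by rewrite -cm -cL iso'// (_ : L - s - L = - s) ?normrN ?gtr0_norm//; lra.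
pose e' := c' (L + s).
have ee' : d e e' = s.
  by rewrite -cL iso'// (_ : L - (L + s) = - s) ?normrN ?gtr0_norm//; lra.
have me' : d (c (L - s)) e' = s + s.
  rewrite -cm iso'// (_ : L - s - (L + s) = - (s + s)); last by lra.
  by rewrite normrN gtr0_norm//; lra.
have ze' : d z e' <= L + s by apply: le_trans (metric_triangle _ e _) _; rewrite ee'.
have Ae' : A e' by apply: zA; rewrite /cball/=; lra.
(* As [e] is the midpoint of [c (L - s)] and [e'], one gets 2 L <= (L - s) + d z e', so [e'] lies at
   distance L + s from z and contradicts the choice of [e]. *)
have := cb_mid convA Az Am Ae' Ae; rewrite me ee' me' zm => /(_ erefl erefl) mid.
have ye' := metric_triangle y e e'; rewrite ee' in ye'.
have : e' \in E by rewrite inE; split => //=; [split => //=; lra|rewrite -/L in mid; lra].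
by move=> /emax; rewrite -/L; rewrite -/L in mid; lra.
Qed.

End Extension.

(** * From first order bounds at a point to bounds on a neighborhood *)

Section Chart.
Context {R : realType} {X : metricType R}.
Local Notation d := (@mdist R X).

Lemma near_dist (x : X) (P : X -> Prop) :
  (\forall y \near x, P y) <-> exists2 e : R, 0 < e & forall y, d x y < e -> P y.
Proof.
split=> [/nbhs_ballP[e /= e0 H]|[e e0 H]].
  by exists e => // y xy; apply: H; rewrite ballEmdist.
by apply/nbhs_ballP; exists e => //= y; rewrite ballEmdist => /H.
Qed.

Variable A : set X.
Hypotheses (convA : convex_ball A) (compA : compact A).
Hypothesis lgc : @locally_geodesically_complete R X.
Variables (x : X) (r : R).
Hypotheses (r0 : 0 < r) (rA : cball x (4 * r) `<=` A).

Let Ax : A x.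
Proof. by apply: rA; rewrite /cball/= mdistxx mulr_ge0// ltW. Qed.

Lemma near_ball y : d x y < 4 * r -> \forall z \near y, A z.
Proof.
move=> xy; apply/near_dist; exists (4 * r - d x y); first by rewrite subr_gt0.
move=> z yz; apply: rA; rewrite /cball/=.
by have := metric_triangle x y z; lra.
Qed.

Let nearA : \forall z \near x, A z.
Proof. by apply: near_ball; rewrite mdistxx mulr_gt0. Qed.

(** Links the two descriptions of a geodesic: the curve, on which angles are measured, and [pt],
    which is continuous and has convexity. *)
Definition ray_to (g : R -> X) q := exists2 l, 0 < l &
  [/\ ray x g l, g l = q, A q & forall t, 0 <= t -> t <= l -> g t = pt A x q t].

Lemma ray_to_from g q : ray_to g q -> geodesic_from x g.
Proof.
move=> [l l0 [rg _ _ _]]; have [g0 gi] := rg.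
by split => //; exists l.
Qed.

Lemma ray_to_dist g q l : ray x g l -> g l = q -> 0 < l -> d x q = l.
Proof. by move=> rg <- l0; exact: (ray_dist rg (ltW l0) (lexx l)). Qed.

Lemma ray_toP g l : 0 < l -> ray x g l -> (forall t, 0 <= t -> t <= l -> A (g t)) ->
  ray_to g (g l).
Proof.
move=> l0 rg gA; have Agl : A (g l) := gA l (ltW l0) (lexx l).
exists l => //; split => // t t0 tl.
have xgl := ray_dist rg (ltW l0) (lexx l).
apply: (geodesic_ptE convA Ax Agl); last by rewrite in_itv/= t0 xgl.
case: rg => g0 gi; split; rewrite ?xgl//.
by move=> u; rewrite in_itv/= => /andP[u0 ul]; exact: gA.
Qed.

(** A nearly right angle gives - cos (angle g h) <= a, and the gap e - a absorbs the error of the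
    first variation. *)
Lemma first_variation_toward g q h q' a e : ray_to g q -> ray_to h q' ->
  angle g h <= pi / 2 + a -> 0 <= a -> a < e ->
  \forall t \near 0^'+, d q (pt A x q' t) < d q x + e * t.
Proof.
move=> gq hq' gh a0 ae; have gg := ray_to_from gq; have gh' := ray_to_from hq'.
have [l l0 [rg gl _ _]] := gq; have [l' l'0 [_ _ _ hE]] := hq'.
have e2 : 0 < (e - a) / 2 by lra.
have cosgh : - cos (angle g h) <= a.
  have := @cosN_sum_le R (angle g h) (pi / 2) a.
  rewrite cos_pihalf subr0; apply => //; last by have := gh; lra.
    by rewrite (angle_ge0 gg gh') (angle_le_pi gg gh').
  by have := @pi_ge0 R; move=> *; apply/andP; split; lra.
near=> t.
have t0 : 0 < t by near: t; exact: nbhs_right_gt.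
have tl' : t < l' by near: t; exact: nbhs_right_lt.
have : d (g l) (h t) <= l + t * ((e - a) / 2 - cos (angle g h)).
  by near: t; exact: (first_variation rg l0 gh' e2).
rewrite (hE _ (ltW t0) (ltW tl')) gl => /le_lt_trans; apply.
rewrite (metric_sym q x) (ray_to_dist rg gl l0) ltrD2l mulrC ltr_pM2r//; lra.
Unshelve. all: by end_near. Qed.

Lemma first_variation_sum g q h q' a e w : ray_to g q -> ray_to h q' ->
  (forall u, geodesic_from x u -> angle g u + angle u h <= pi + a) ->
  0 <= a -> a < e -> A w -> x != w ->
  \forall t \near 0^'+,
    d q (pt A x w t) + d q' (pt A x w t) < d q x + d q' x + e * t.
Proof.
move=> gq hq' gh a0 ae Aw xw; have gg := ray_to_from gq; have gh' := ray_to_from hq'.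
have [l l0 [rg gl _ _]] := gq; have [l' l'0 [rh hl _ _]] := hq'.
have e4 : 0 < (e - a) / 4 by lra.
have xw0 : 0 < d x w by rewrite mdist_gt0.
have gw : geodesic_from x (pt A x w).
  by split; [exact: pt0|exists (d x w) => //; exact: pt_isometric].
have cosgh : - cos (angle g (pt A x w)) - cos (angle h (pt A x w)) <= a.
  rewrite (angle_sym gh' gw); apply: cosN_sum_le => //; last exact: gh.
    by rewrite (angle_ge0 gg gw) (angle_le_pi gg gw).
  by rewrite (angle_ge0 gw gh') (angle_le_pi gw gh').
near=> t.
have t0 : 0 < t by near: t; exact: nbhs_right_gt.
have : d (g l) (pt A x w t) <= l + t * ((e - a) / 4 - cos (angle g (pt A x w))).
  by near: t; exact: (first_variation rg l0 gw e4).
have : d (h l') (pt A x w t) <= l' + t * ((e - a) / 4 - cos (angle h (pt A x w))).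
  by near: t; exact: (first_variation rh l'0 gw e4).
rewrite gl hl (metric_sym q x) (metric_sym q' x) (ray_to_dist rg gl l0).
rewrite (ray_to_dist rh hl l'0) => h1 h2.
have : t * (- cos (angle g (pt A x w)) - cos (angle h (pt A x w))) <= t * a.
  by rewrite ler_pM2l.
have : t * a < t * e by rewrite ltr_pM2l.
have := mulr_gt0 t0 e4; lra.
Unshelve. all: by end_near. Qed.

(* The first order bound at x becomes a bound at a fixed scale near x, and
   convexity propagates it down to all smaller scales. *)
Lemma lipschitz_sum q q' e : A q -> A q' -> 0 <= e ->
  (forall w, A w -> x != w -> \forall t \near 0^'+,
    d q (pt A x w t) + d q' (pt A x w t) < d q x + d q' x + e * t) ->
  exists2 rho, 0 < rho & forall y z, d x y < rho -> d x z < rho ->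
    d q y + d q' y <= d q z + d q' z + e * d y z.
Proof.
move=> Aq Aq' e0 fv; pose S y := d q y + d q' y.
have cS (I : Type) (F : set_system I) (FF : Filter F) (f : I -> X) u :
    f @ F --> u -> S (f i) @[i --> F] --> S u.
  by move=> fu; apply: cvgD; apply: cvg_mdist => //; exact: cvg_cst.
(* An annulus containing the far ends of the prolonged segments used below: these have length r and
   start within r / 2 of x. *)
pose K := A `&` [set w | d x w <= 3 * r] `&` [set w | r / 2 <= d x w].
have cK : compact K.
  apply: (subclosed_compact _ compA); last by move=> w [[]].
  apply: closedI; first apply: closedI.
  - by apply: compact_closed => //; exact: metric_hausdorff.
  - by apply: closed_dist_le; [exact: continuous_dist|move=> w; exact: cvg_cst].
  - by apply: closed_dist_le; [move=> w; exact: cvg_cst|exact: continuous_dist].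
pose good (zt : X * R) w := S (pt A zt.1 w zt.2) <= S zt.1 + e * zt.2.
have : \forall zt \near filter_prod (nbhs x) 0^'+, K `<=` good zt.
  move/compact_near_coveringP : cK; apply => w [[Aw /= w3] w2].
  have xw : x != w by rewrite -mdist_gt0; apply: lt_le_trans w2; rewrite divr_gt0.
  have nearw : \forall w' \near w, A w' by apply: near_ball; have := r0; lra.
  have : \forall t \near (0 : R)^'+, [/\ 0 < t, t < d x w & S (pt A x w t) < S x + e * t].
    near=> t; split; near: t; [exact: nbhs_right_gt| |exact: fv].
    by apply: nbhs_right_lt; rewrite mdist_gt0.
  move=> /filter_ex[t [t0 txw St]].
  pose G := filter_prod (nbhs w) (filter_prod (nbhs x) (0 : R)^'+).
  have c1 : (fun u : X * (X * R) => u.1) @ G --> w by exact: cvg_fst.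
  have c2 : (fun u : X * (X * R) => u.2.1) @ G --> x.
    by apply: cvg_comp cvg_snd _; exact: cvg_fst.
  have c3 : (fun u : X * (X * R) => u.2.2) @ G `=>` (0 : R)^'+.
    by apply: cvg_comp cvg_snd _; exact: cvg_snd.
  have cp : pt A u.2.1 u.1 t @[u --> G] --> pt A x w t.
    by apply: cvg_pt => //; [exact: c2 nearA|exact: c1 nearw|exact: cvg_cst].
  suff : \forall u \near G, good u.2 u.1 by apply: filterS => -[].
  near=> u.
  have [t0' ut] : 0 < u.2.2 /\ u.2.2 < t.
    split; near: u; first exact: c3 (nbhs_right_gt _).
    exact: c3 (nbhs_right_lt t0).
  have Au : A u.2.1 by near: u; exact: c2 nearA.
  have Au' : A u.1 by near: u; exact: c1 nearw.
  have tu : t < d u.2.1 u.1.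
    by near: u; apply: (cvgr_gt (d x w)) => //; exact: cvg_mdist.
  have Stu : S (pt A u.2.1 u.1 t) < S u.2.1 + e * t.
    near: u; have cl : S u.2.1 + e * t - S (pt A u.2.1 u.1 t) @[u --> G] -->
        S x + e * t - S (pt A x w t).
      by apply: cvgB; [apply: cvgD; [exact: cS|exact: cvg_cst]|exact: cS].
    have := cvgr_gt _ cl 0; rewrite subr_gt0 => /(_ _ St).
    by apply: filterS => u; rewrite subr_gt0.
  have s1 := convex_slope convA compA Aq Au Au' (ltW t0') (ltW ut) (ltW tu).
  have s2 := convex_slope convA compA Aq' Au Au' (ltW t0') (ltW ut) (ltW tu).
  rewrite /good -(ler_pM2l t0).
  have : u.2.2 * (S (pt A u.2.1 u.1 t) - S u.2.1) <= u.2.2 * (e * t).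
    by apply: ler_wpM2l; [exact: ltW|lra].
  by move: s1 s2; rewrite /S; lra.
case=> -[U V] /= [/near_dist[r1 r10 HU] /near_rightP[r2 r20 HV]] UV.
pose rho := Num.min (Num.min r1 (r2 / 2)) (r / 2).
have rho0 : 0 < rho by rewrite !lt_min r10 !divr_gt0.
have [rho1 rho2 rho3] : [/\ rho <= r1, rho <= r2 / 2 & rho <= r / 2].
  by split; rewrite !ge_min lexx ?orbT.
exists rho => // y z xy xz; have [->|yz] := eqVneq y z.
  by rewrite mdistxx mulr0 addr0.
have yz2 : d z y < rho + rho.
  by have := metric_triangle z x y; rewrite (metric_sym z x); lra.
have Ay : A y by apply: rA; rewrite /cball/=; lra.
(* The segment from z to y may be arbitrarily short; prolonged beyond y to length r, it ends in [K]
   and meets y at parameter d z y. *)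
have [|||w [Aw zw wE]] := geodesic_extension convA compA lgc Ay (l := r) (z := z).
- by rewrite eq_sym.
- lra.
- by move=> w; rewrite /cball/= => zw; apply: rA; rewrite /cball/=;
    have := metric_triangle x z w; lra.
have zy0 : 0 < d z y by rewrite mdist_gt0 eq_sym.
have : K w.
  have := metric_triangle x z w; have := metric_triangle z x w.
  rewrite (metric_sym z x) zw => *.
  by split; [split => //=; lra|rewrite /=; lra].
have /UV gd : (U `*` V) (z, d z y).
  by split => /=; [apply: HU; lra|apply: HV => //; lra].
by move=> /gd; rewrite /good/= wE /S (metric_sym z y).
Unshelve. all: by end_near. Qed.

(* Both families of endpoints: P i false is the strainer point p_i and P i true
   a point in an approximately opposite direction. *)
Record strainer_chart (delta : R) k (P : 'I_k -> bool -> X) (rho : R) : Prop := {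
  sc_gt0 : 0 < rho;
  sc_le : rho <= r;
  sc_in : forall i b, A (P i b);
  sc_far : forall y i b, d x y < rho -> rho <= d y (P i b);
  sc_slope : forall y t i j b b', d x y < rho -> i != j -> 0 <= t -> t <= rho ->
    d (P j b') (pt A y (P i b) t) <= d (P j b') y + 2 * delta * t;
  sc_lip : forall i y z, d x y < rho -> d x z < rho ->
    d (P i false) y + d (P i true) y <=
    d (P i false) z + d (P i true) z + 2 * delta * d y z }.

(** The opposite geodesics are chosen with error delta / 2. All angle conditions then hold with 3/2
    delta, and what remains up to 2 delta makes the first order bounds strict, hence stable under
    moving the base point. *)
Lemma strainer_chart_exists (delta : R) k (p : 'I_k -> X) : 0 < delta ->
  (forall i, ray_to (geod x (p i)) (p i)) ->
  spherical_tuple x delta (fun i => dir x (p i)) ->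
  exists P rho, strainer_chart delta P rho /\ forall i, P i false = p i.
Proof.
move=> delta0 rp sph; have de0 : 0 < delta / 2 by rewrite divr_gt0.
have [c [gc opp off]] := opposite_geodesics sph (fun i => ray_to_from (rp i)) de0.
have /choice[q rq] : forall i, exists q, ray_to (c i) q.
  move=> i; have [l l0 rc] := geodesic_from_ray (gc i).
  pose m := Num.min l r; have m0 : 0 < m by rewrite lt_min l0.
  have [ml mr] : m <= l /\ m <= r by rewrite !ge_min !lexx orbT.
  exists (c i m); apply: ray_toP => //; first exact: ray_sub rc.
  move=> t t0 tm; apply: rA; rewrite /cball/= (ray_dist (ray_sub ml rc))//.
  by have := r0; lra.
pose g i (b : bool) := if b then c i else geod x (p i).
pose P i (b : bool) := if b then q i else p i.
have rP i b : ray_to (g i b) (P i b) by case: b; [exact: rq|exact: rp].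
have PA i b : A (P i b) by have [l _ []] := rP i b.
have Px i b : 0 < d x (P i b).
  by have [l l0 [rg gl _ _]] := rP i b; rewrite (ray_to_dist rg gl).
have gg i b : geodesic_from x (g i b) by exact: ray_to_from (rP i b).
have ang i j b b' : i != j -> angle (g j b') (g i b) <= pi / 2 + (delta + delta / 2).
  move=> ij; have [h1 h2 h3] := off _ _ ij.
  rewrite eq_sym in ij; have [h4 h5 h6] := off _ _ ij.
  rewrite addrA; case: b; case: b'; [exact: h6|exact: h4| |exact: h5].
  by rewrite (angle_sym (gg j true) (gg i false)); exact: h1.
have : \forall t \near (0 : R)^'+, forall i j b b', i != j ->
    d (P j b') (pt A x (P i b) t) < d (P j b') x + 2 * delta * t.
  do 4 (apply: filter_forall => ?).
  have [->|ij] := eqVneq; first by apply: nearW.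
  have de1 : 0 <= delta + delta / 2 by lra.
  have de2 : delta + delta / 2 < 2 * delta by lra.
  have := first_variation_toward (rP _ _) (rP _ _) (ang _ _ _ _ ij) de1 de2.
  by move=> fv; apply: filterS (fv _ _) => t h _; exact: h.
have : \forall t \near (0 : R)^'+, forall i b, t < d x (P i b).
  by do 2 (apply: filter_forall => ?); exact: nbhs_right_lt.
move=> nfar nslope.
(* One scale T serves all pairs of endpoints; as [rho] is taken below T, it also keeps the endpoints
   at distance at least [rho]. *)
have /filter_ex[T [T0 [Tfar Tslope]]] : \forall t \near (0 : R)^'+, 0 < t /\
    ((forall i b, t < d x (P i b)) /\ forall i j b b', i != j ->
    d (P j b') (pt A x (P i b) t) < d (P j b') x + 2 * delta * t).
  by near=> t; split; [near: t; exact: nbhs_right_gt|split; near: t].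
have cstx u : (u : X) @[_ --> nbhs x] --> u by exact: cvg_cst.
have near1 : \forall y \near x, forall i b, T < d y (P i b).
  do 2 (apply: filter_forall => ?); apply: (cvgr_gt _ _ _ (Tfar _ _)).
  by apply: cvg_mdist; [exact: cvg_id|exact: cvg_cst].
have near2 : \forall y \near x, forall i j b b', i != j ->
    d (P j b') (pt A y (P i b) T) < d (P j b') y + 2 * delta * T.
  apply: filter_forall => i; apply: filter_forall => j.
  apply: filter_forall => b; apply: filter_forall => b'.
  have [->|ij] := eqVneq i j; first by apply: nearW.
  have cl : d (P j b') y + 2 * delta * T - d (P j b') (pt A y (P i b) T) @[y --> x]
      --> d (P j b') x + 2 * delta * T - d (P j b') (pt A x (P i b) T).
    apply: cvgB.
      by apply: cvgD; [exact: continuous_dist|exact: cvg_cst].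
    apply: cvg_mdist; first exact: cvg_cst.
    by apply: cvg_pt => //; [exact: nearW|exact: cvg_cst].
  have := cvgr_gt _ cl 0; rewrite subr_gt0 => /(_ _ (Tslope _ _ _ _ ij)).
  by apply: filterS => y; rewrite subr_gt0.
have lip i : exists2 rho, 0 < rho & forall y z, d x y < rho -> d x z < rho ->
    d (P i false) y + d (P i true) y <=
    d (P i false) z + d (P i true) z + 2 * delta * d y z.
  apply: lipschitz_sum => //; first by rewrite mulr_ge0// ltW.
  move=> w Aw xw; apply: (first_variation_sum (rP i false) (rP i true)
    (a := delta + delta / 2)) => //; try lra.
  by move=> u gu; rewrite addrA; exact: opp.
have : \forall rho \near (0 : R)^'+, forall i y z, d x y < rho -> d x z < rho ->
    d (P i false) y + d (P i true) y <=
    d (P i false) z + d (P i true) z + 2 * delta * d y z.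
  apply: filter_forall => i; have [rho rho0 H] := lip i.
  apply/near_rightP; exists rho => // t t0 trho y z xy xz.
  by apply: H; [exact: lt_trans trho|exact: lt_trans trho].
move: near1 near2 => /near_dist[r1 r10 near1] /near_dist[r2 r20 near2] near4.
have /filter_ex[rho [[rho0 rhor] [rho1 rho2] [rhoT H]]] : \forall rho \near (0 : R)^'+,
  [/\ 0 < rho /\ rho < r, rho < r1 /\ rho < r2 & rho < T /\
   forall i y z, d x y < rho -> d x z < rho ->
    d (P i false) y + d (P i true) y <=
    d (P i false) z + d (P i true) z + 2 * delta * d y z].
  by near=> rho; split; split; near: rho => //;
    first exact: nbhs_right_gt; exact: nbhs_right_lt.
exists P, rho; split => //; split => //.
- exact: ltW.
- by move=> y i b xy; apply/ltW/(lt_trans rhoT)/near1/(lt_trans xy).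
- move=> y t i j b b' xy ij t0 trho.
  have Ay : A y by apply: rA; rewrite /cball/=; have := r0; lra.
  have tT : t <= T by exact: le_trans (ltW rhoT).
  have Ty : T < d y (P i b) by apply/near1/(lt_trans xy).
  have sl := convex_slope convA compA (PA j b') Ay (PA i b) t0 tT (ltW Ty).
  have := near2 _ (lt_trans xy rho2) _ _ b b' ij => Ts.
  have : t * (d (P j b') (pt A y (P i b) T) - d (P j b') y) <= t * (2 * delta * T).
    by apply: ler_wpM2l => //; lra.
  move=> le1; rewrite -lerBlDl -(ler_pM2l T0); lra.
Unshelve. all: by end_near. Qed.

End Chart.

(** * Retraction onto a fiber *)

Section Retraction.
Context {R : realType} {X : metricType R}.
Local Notation d := (@mdist R X).
Variable A : set X.
Hypotheses (convA : convex_ball A) (compA : compact A).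
Variables (x : X) (r : R).
Hypotheses (rA : cball x (4 * r) `<=` A).
Variables (delta : R) (k : nat) (P : 'I_k -> bool -> X) (rho : R).
Hypotheses (delta0 : 0 <= delta) (dk : 20 * k%:R * delta <= 1).
Hypothesis chart : strainer_chart A x r delta P rho.

Let rho0 : 0 < rho. Proof. exact: sc_gt0 chart. Qed.

Let inA y : d x y < rho -> A y.
Proof.
move=> xy; apply: rA; rewrite /cball/=.
by have := sc_le chart; have := rho0; lra.
Qed.

Let PA i b : A (P i b). Proof. exact: sc_in chart i b. Qed.

Lemma pt_le0 y z t : A y -> A z -> t <= 0 -> pt A y z t = y.
Proof.
move=> Ay Az t0; have [_ + _] := pt_segment convA Ay Az t.
have -> : clamp t (d y z) = 0.
  rewrite /clamp; have -> : Num.min t (d y z) = t.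
    by apply/min_idPl; exact: le_trans (mdist_ge0 _ _).
  exact/max_idPl.
by move/mdist_positivity.
Qed.

(* For either sign of s one of the two movements is trivial, as pt clamps a
   negative parameter to 0. *)
Definition move i y s := pt A (pt A y (P i true) s) (P i false) (- s).

Lemma move_in i y s : A y -> A (move i y s).
Proof. by move=> Ay; apply: pt_in => //; exact: pt_in. Qed.

Lemma move_ge0 i y s : A y -> 0 <= s -> move i y s = pt A y (P i true) s.
Proof. by move=> Ay s0; rewrite /move pt_le0 ?oppr_le0//; exact: pt_in. Qed.

Lemma move_le0 i y s : A y -> s <= 0 -> move i y s = pt A y (P i false) (- s).
Proof. by move=> Ay s0; rewrite /move (pt_le0 _ _ s0). Qed.

Lemma move_dist i y s : d x y < rho -> `|s| <= rho -> d y (move i y s) = `|s|.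
Proof.
move=> xy sr; have Ay := inA xy.
have [s0|/ltW s0] := leP 0 s.
  rewrite (ger0_norm s0) in sr *; rewrite move_ge0// pt_distl//.
  exact: le_trans sr (sc_far chart _ _ xy).
rewrite (ler0_norm s0) in sr *; rewrite move_le0// pt_distl ?oppr_ge0//.
exact: le_trans sr (sc_far chart _ _ xy).
Qed.

Lemma move_slope i j b y s : d x y < rho -> `|s| <= rho -> i != j ->
  d (P j b) (move i y s) <= d (P j b) y + 2 * delta * `|s|.
Proof.
move=> xy sr ij; have Ay := inA xy.
have [s0|/ltW s0] := leP 0 s.
  rewrite (ger0_norm s0) in sr *; rewrite move_ge0//.
  exact: (sc_slope chart).
rewrite (ler0_norm s0) in sr *; rewrite move_le0//.
by apply: (sc_slope chart) => //; rewrite oppr_ge0.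
Qed.

(** For j <> i both d(p_j, -) and d(q_j, -) grow by at most 2 delta |s|, while their sum is constant
    up to 2 delta |s|; a lower bound with 4 delta follows. For j = i, moving towards p_i is exact,
    and moving towards q_i is exact for d(q_i, -), which the sum transfers to d(p_i, -). *)
Lemma move_coord i j y s : d x y < rho -> `|s| <= rho -> d x (move i y s) < rho ->
  `|d (P j false) (move i y s) - d (P j false) y - (if i == j then s else 0)|
    <= 4 * delta * `|s|.
Proof.
move=> xy sr xm; have Ay := inA xy; have ym := move_dist i xy sr.
have l1 := sc_lip chart j xy xm; have l2 := sc_lip chart j xm xy.
rewrite (metric_sym (move i y s) y) in l2; rewrite ym in l1 l2.
have ds : 0 <= delta * `|s| by rewrite mulr_ge0.
have [ij|ij] := eqVneq i j; last first.
  have s1 := move_slope false xy sr ij; have s2 := move_slope true xy sr ij.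
  by rewrite subr0 ler_norml; apply/andP; split; lra.
rewrite -ij /= in l1 l2 *.
have [s0|/ltW s0] := leP 0 s.
  have : d (P i true) (move i y s) = d (P i true) y - s.
    rewrite move_ge0// !(metric_sym (P i true)) pt_distr//.
    rewrite (ger0_norm s0) in sr; exact: le_trans sr (sc_far chart _ _ xy).
  by move=> e; rewrite ler_norml; apply/andP; split; lra.
have -> : d (P i false) (move i y s) = d (P i false) y + s.
  rewrite move_le0// !(metric_sym (P i false)) pt_distr ?oppr_ge0 ?opprK//.
  rewrite (ler0_norm s0) in sr; exact: le_trans sr (sc_far chart _ _ xy).
by rewrite addrAC addrK subrr normr0; lra.
Qed.

Definition moves (e : 'I_k -> R) y (l : seq 'I_k) :=
  foldl (fun z i => move i z (e i)) y l.

Lemma moves_in e y l : A y -> A (moves e y l).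
Proof. by elim: l y => //= i l IH y Ay; apply: IH; exact: move_in. Qed.

Lemma moves_estimate e y l : d x y + \sum_(i <- l) `|e i| < rho ->
  d y (moves e y l) <= \sum_(i <- l) `|e i| /\
  forall j, `|d (P j false) (moves e y l) - d (P j false) y
     - \sum_(i <- l | i == j) e i| <= 4 * delta * \sum_(i <- l) `|e i|.
Proof.
elim: l y => [|i l IH] y /=.
  move=> _; rewrite !big_nil mdistxx; split => // j.
  by rewrite big_nil !subr0 subrr normr0 mulr0.
rewrite big_cons => yl; set s := \sum_(u <- l) `|e u| in yl IH *.
have s0 : 0 <= s by exact: sumr_ge0.
have n0 := normr_ge0 (e i); have d0 := mdist_ge0 x y.
have xy : d x y < rho by lra.
have er : `|e i| <= rho by lra.
have ym := move_dist i xy er.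
have xm : d x (move i y (e i)) <= d x y + `|e i| by rewrite -ym metric_triangle.
have [|dz Fz] := IH (move i y (e i)); first by lra.
split; first by apply: le_trans (metric_triangle _ (move i y (e i)) _) _; rewrite ym; lra.
move=> j; rewrite big_cons; have Fm := @move_coord i j y (e i) xy er.
have {}Fm := Fm (le_lt_trans xm _); have {}Fz := Fz j.
have {}Fm := Fm ltac:(lra).
set G := \sum_(u <- l | u == j) e u in Fz *.
rewrite (_ : (if i == j then e i + G else G) = (if i == j then e i else 0) + G); last first.
  by case: (i == j) => //; rewrite add0r.
move: (if i == j then e i else 0) Fm => c Fm.
move: Fm Fz; rewrite !ler_norml => /andP[m1 m2] /andP[z1 z2].
by apply/andP; split; lra.
Qed.

Lemma cvg_moves {T : Type} (G : set_system T) (FG : Filter G) (f : T -> X)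
    (h : T -> 'I_k -> R) y e l :
  A y -> (\forall u \near G, A (f u)) -> f @ G --> y ->
  (forall i, h u i @[u --> G] --> e i) ->
  moves (h u) (f u) l @[u --> G] --> moves e y l.
Proof.
move=> + + + hG; elim: l f y => [//|i l IH] f y Ay Af fG /=; apply: IH.
- exact: move_in.
- by apply: filterS Af => u; exact: move_in.
- apply: cvg_pt => //.
  + exact: pt_in.
  + by apply: filterS Af => u Au; exact: pt_in.
  + exact: nearW.
  + by apply: cvg_pt => //; [exact: nearW|exact: cvg_cst].
  + exact: cvg_cst.
  + by apply: cvgN; exact: hG.
Qed.

Section Target.
Variable omega : 'I_k -> R.

Definition defect y : R := \sum_i `|omega i - d (P i false) y|.

Lemma defect_ge0 y : 0 <= defect y. Proof. exact: sumr_ge0. Qed.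

Lemma cvg_defect {T : Type} (G : set_system T) (FG : Filter G) (f : T -> X) y :
  f @ G --> y -> defect (f u) @[u --> G] --> defect y.
Proof.
move=> fG; apply: cvg_big => // [|i _].
  by move=> z; exact: add_continuous.
apply: cvg_norm; apply: cvgB; first exact: cvg_cst.
by apply: cvg_mdist => //; exact: cvg_cst.
Qed.

(** All step lengths are read off at the starting point; the errors caused by the moves of a pass
    are left to the next one. *)
Definition correct y := moves (fun i => omega i - d (P i false) y) y (enum 'I_k).

Lemma correct_in y : A y -> A (correct y). Proof. exact: moves_in. Qed.

(** Here 5/4 of the defect bounds the total length of all passes, so the whole iteration stays in
    the chart. *)
Definition basin : set X := [set y | d x y + 5 / 4 * defect y < rho].

Lemma basin_in y : basin y -> A y.
Proof.
by move=> by_; apply: inA; move: by_; rewrite /basin/=; have := defect_ge0 y; lra.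
Qed.

Lemma correct_estimate y : basin y ->
  d y (correct y) <= defect y /\ 5 * defect (correct y) <= defect y.
Proof.
rewrite /basin/= => yb; have f0 := defect_ge0 y.
have sumE : \sum_(i <- enum 'I_k) `|omega i - d (P i false) y| = defect y.
  by rewrite big_enum.
have [|dy Fy] := @moves_estimate (fun i => omega i - d (P i false) y) y (enum 'I_k).
  by rewrite sumE; lra.
rewrite sumE in dy Fy; split => //.
have : defect (correct y) <= \sum_(i < k) (4 * delta * defect y).
  apply: ler_sum => j _; have := Fy j.
  rewrite big_enum_cond/= (big_pred1 j); last by [].
  rewrite (_ : _ - _ - _ = d (P j false) (correct y) - omega j); last by ring.
  by rewrite distrC.
rewrite sumr_const card_ord -mulr_natl => le1.
have : 20 * k%:R * delta * defect y <= defect y by rewrite ler_piMl.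
by lra.
Qed.

(** Travelled distance plus 5/4 of the defect does not grow: a pass from defect f costs at most f
    and lowers 5/4 f by at least 5/4 (f - f / 5) = f. *)
Lemma iter_estimate n y : basin y ->
  [/\ basin (iter n correct y),
    d y (iter n correct y) + 5 / 4 * defect (iter n correct y) <= 5 / 4 * defect y &
    5 ^+ n * defect (iter n correct y) <= defect y].
Proof.
move=> yb; elim: n => [|n [nb nd nf]].
  by rewrite /= mdistxx add0r expr0 mul1r.
have [c1 c2] := correct_estimate nb.
have t1 := metric_triangle y (iter n correct y) (iter n.+1 correct y).
have dn : d y (iter n.+1 correct y) + 5 / 4 * defect (iter n.+1 correct y)
    <= 5 / 4 * defect y by rewrite /= in t1 *; lra.
split => //.
  have := metric_triangle x y (iter n.+1 correct y).
  by move: yb; rewrite /basin/= in dn *; lra.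
apply: le_trans nf; rewrite exprSr -mulrA ler_pM2l//.
Qed.

(** The limit of the iterates, encoded by its rate of convergence, which is what the fiber property
    and continuity use. *)
Definition correction_limit y l := forall n,
  5 ^+ n * d (iter n correct y) l <= 5 / 4 * defect y.

Definition retraction y : X := xget y (correction_limit y).

Lemma retraction_approx y n : basin y ->
  5 ^+ n * d (iter n correct y) (retraction y) <= 5 / 4 * defect y.
Proof.
move=> yb; suff /xgetPex : exists l, correction_limit y l by apply.
pose u m := iter m correct y.
have uA : (u @ \oo) A.
  by exists 0%N => // m _; apply: basin_in; have [] := iter_estimate m yb.
(* Any cluster point will do: the bound on the distance from iterate n to all later iterates passes
   to it. *)
have [l [_ cl]] := compA _ uA; exists l => {}n.
have p5 : 0 < 5 ^+ n :> R by exact: exprn_gt0.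
rewrite mulrC -ler_pdivlMr//; apply/ler_addgt0Pr => e e0.
have un : (u @ \oo) [set u m | m in [set m | (n <= m)%N]].
  by exists n => // m nm; exists m.
have lb : nbhs l (ball l e) by apply/nbhs_ballP; exists e.
have [_ [[p /= nm <-] lz]] := cl _ _ un lb.
rewrite ballEmdist /= metric_sym in lz.
apply: le_trans (metric_triangle _ (u p) _) _; apply: lerD; last exact: ltW.
have [nb _ nf] := iter_estimate n yb.
have [_ + _] := iter_estimate (p - n) nb; rewrite -iterD subnK//.
rewrite -/(u p) ler_pdivlMr// => le1.
have := defect_ge0 (u p).
have : 5 ^+ n * d (u n) (u p) <= 5 ^+ n * (5 / 4 * defect (u n)).
  by rewrite ler_pM2l//; have := defect_ge0 (u p); rewrite /u in le1 *; lra.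
by rewrite /u; lra.
Qed.

Lemma retraction_dist y : basin y -> d y (retraction y) <= 5 / 4 * defect y.
Proof. by move=> yb; have := retraction_approx 0 yb; rewrite expr0 mul1r. Qed.

Lemma geometric_small (e c : R) : 0 < e -> 0 <= c -> exists n, c < 5 ^+ n * e.
Proof.
move=> e0 c0; pose n := Num.bound (c / e); exists n.
rewrite -ltr_pdivrMr//; have : c / e < n%:R by exact: archi_boundP (divr_ge0 c0 (ltW e0)).
move=> /lt_le_trans; apply.
by rewrite -natrX ler_nat ltnW// ltn_expl.
Qed.

Lemma retraction_fiber y i : basin y -> d (P i false) (retraction y) = omega i.
Proof.
move=> yb; apply/eqP; rewrite -subr_eq0 -normr_le0; apply/ler_addgt0Pr => e e0.
rewrite add0r.
(* The constant 3 exceeds 5/4 + 1, for the distance to the limit and the defect left after n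
   passes. *)
have [n en] := geometric_small e0 (mulr_ge0 (ler0n _ 3) (defect_ge0 y)).
have p5 : 0 < 5 ^+ n :> R by exact: exprn_gt0.
have ap := retraction_approx n yb; have [_ _ nf] := iter_estimate n yb.
have li := mdist_lip (P i false) (P i false) (retraction y) (iter n correct y).
rewrite mdistxx add0r (metric_sym (retraction y)) in li.
have de : `|omega i - d (P i false) (iter n correct y)| <= defect (iter n correct y).
  by rewrite /defect (bigD1 i)//= lerDl sumr_ge0.
rewrite -(ler_pM2l p5).
have t : `|d (P i false) (retraction y) - omega i| <=
    d (iter n correct y) (retraction y) + defect (iter n correct y).
  apply: le_trans (ler_distD (d (P i false) (iter n correct y)) _ _) _.
  by apply: lerD => //; rewrite distrC.
have := ler_wpM2l (ltW p5) t; have := defect_ge0 y; lra.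
Qed.

Lemma cvg_iter_correct {T : Type} (G : set_system T) (FG : Filter G) (f : T -> X) y n :
  A y -> (\forall u \near G, A (f u)) -> f @ G --> y ->
  iter n correct (f u) @[u --> G] --> iter n correct y.
Proof.
move=> Ay Af fG; elim: n => [//|n IH] /=.
have An z : A z -> A (iter n correct z).
  by move=> Az; elim: n {IH} => //= n; exact: correct_in.
apply: cvg_moves => //; first exact: An.
  by apply: filterS Af => u; exact: An.
by move=> i; apply: cvgB; [exact: cvg_cst|apply: cvg_mdist => //; exact: cvg_cst].
Qed.

Lemma near_basin y : basin y -> \forall z \near y, basin z.
Proof.
move=> yb; have : d x z + 5 / 4 * defect z @[z --> y] --> d x y + 5 / 4 * defect y.
  apply: cvgD; first exact: continuous_dist.
  by apply: cvgMr; apply: cvg_defect; exact: cvg_id.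
by move=> /cvgr_lt /(_ _ yb).
Qed.

(** A uniform limit of continuous maps: on the basin 5/4 of the defect is below [rho], so the rate
    of convergence does not depend on the point. *)
Lemma retraction_continuous y : basin y -> {for y, continuous retraction}.
Proof.
move=> yb; apply/metricType_numDomainType.cvgrPdist_lt => e e0.
have e3 : 0 < e / 3 by rewrite divr_gt0.
have [n en] := geometric_small e3 (ltW rho0).
have p5 : 0 < 5 ^+ n :> R by exact: exprn_gt0.
have near_b := near_basin yb.
have : iter n correct z @[z --> y] --> iter n correct y.
  by apply: cvg_iter_correct => //; [exact: basin_in|apply: filterS near_b; exact: basin_in].
move=> /metricType_numDomainType.cvgrPdist_lt/(_ _ e3) near_n.
have close z : basin z -> d (iter n correct z) (retraction z) < e / 3.
  move=> zb; rewrite -(ltr_pM2l p5); apply: le_lt_trans en.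
  apply: le_trans (retraction_approx n zb) _.
  by move: zb; rewrite /basin/=; have := mdist_ge0 x z; lra.
near=> z.
have zb : basin z by near: z.
have nz : d (iter n correct y) (iter n correct z) < e / 3 by near: z.
have := close _ zb; have := close _ yb; rewrite (metric_sym (iter n correct y)).
have := metric_triangle (retraction y) (iter n correct y) (retraction z).
have := metric_triangle (iter n correct y) (iter n correct z) (retraction z).
lra.
Unshelve. all: by end_near. Qed.

End Target.
End Retraction.

(** * Contracting balls of fibers *)

Section StrainerMap.
Context {R : realType} {X : metricType R}.
Local Notation d := (@mdist R X).

(** The curve [geod] is chosen among geodesics of the whole space, but its length keeps it in a ball
    contained in [A], where it agrees with [pt]. *)
Lemma geod_ray_to (A : set X) x r q : convex_ball A -> 0 < r ->
  cball x (4 * r) `<=` A -> q != x -> cball x (d x q) `<=` A ->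
  ray_to A x (geod x q) q.
Proof.
move=> convA r0 rA qx xqA.
have inA y : d x y <= d x q -> A y by exact: xqA.
have Ax : A x by apply: inA; rewrite mdistxx mdist_ge0.
have [c0 cL _ ci] : geodesic_in d [set: X] x q (geod x q).
  apply: xgetPex; have [c [c0 cL _ ci]] := cb_geod convA Ax (inA _ (lexx _)).
  by exists c.
have l0 : 0 < d x q by rewrite mdist_gt0 eq_sym.
have rg : ray x (geod x q) (d x q) by [].
rewrite -{2}cL; apply: (ray_toP convA r0 rA) => // t t0 tl.
by apply: inA; rewrite (ray_dist rg).
Qed.

Lemma strainer_chart_shrink (A : set X) x r delta k (P : 'I_k -> bool -> X) rho rho' :
  strainer_chart A x r delta P rho -> 0 < rho' -> rho' <= rho ->
  strainer_chart A x r delta P rho'.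
Proof.
move=> [r0 rr PA far slope lip] r'0 r'r; split => //.
- exact: le_trans rr.
- by move=> y i b xy; apply: le_trans r'r (far _ _ _ (lt_le_trans xy r'r)).
- move=> y t i j b b' xy ij t0 tr.
  by apply: slope => //; [exact: lt_le_trans r'r|exact: le_trans r'r].
- by move=> i y z xy xz; apply: lip; [exact: lt_le_trans r'r|exact: lt_le_trans r'r].
Qed.

(* On a geodesic between two points of a fiber, convexity bounds d_p from above
   and d_q from below, while d_p + d_q is almost constant. *)
Lemma defect_on_segment (A : set X) x r delta k (P : 'I_k -> bool -> X) rho y z s :
  convex_ball A -> compact A -> cball x (4 * r) `<=` A -> 0 <= delta ->
  strainer_chart A x r delta P rho ->
  d x y < rho -> d x z < rho -> d x (pt A y z (s * d y z)) < rho ->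
  0 <= s -> s <= 1 ->
  (forall i, d (P i false) y = d (P i false) z) ->
  defect P (fun i => d (P i false) z) (pt A y z (s * d y z)) <=
    4 * k%:R * delta * (s * d y z).
Proof.
move=> convA compA rA delta0 chart xy xz xm s0 s1 yz.
have rr := sc_le chart; have rho0 := sc_gt0 chart.
have inA u : d x u < rho -> A u by move=> xu; apply: rA; rewrite /cball/=; lra.
set D := d y z in xm *; set m := pt A y z (s * D) in xm *.
have D0 : 0 <= D by exact: mdist_ge0.
have sD0 : 0 <= s * D by exact: mulr_ge0.
have sDD : s * D <= D by exact: ler_piMl.
have ym : d y m = s * D by rewrite pt_distl//; exact: inA.
have mz : d m z = D - s * D by rewrite pt_distr//; exact: inA.
rewrite -[X in _ <= X]mulrA -[X in X * _]mulrC.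
have : defect P (fun i => d (P i false) z) m <= \sum_(i < k) (4 * delta * (s * D)).
  apply: ler_sum => i _; set f := d (P i false); set g := d (P i true).
  have conv q : A q -> d q m <= (1 - s) * d q y + s * d q z.
    move=> Aq; have [D0'|D0'] := eqVneq D 0.
      have -> : m = y by apply/esym/mdist_positivity; rewrite ym D0' mulr0.
      have -> : z = y by apply/esym/mdist_positivity.
      by lra.
    have Dp : 0 < D by rewrite lt_def D0'.
    rewrite -(ler_pM2l Dp).
    have := convex_dist convA compA Aq (inA _ xy) (inA _ xz) sD0 sDD.
    by rewrite -/D -/m; lra.
  have cf := conv _ (sc_in chart i false); have cg := conv _ (sc_in chart i true).
  have l1 := sc_lip chart i xy xm; have l2 := sc_lip chart i xz xm.
  rewrite (metric_sym z) mz in l2; rewrite ym in l1.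
  rewrite -/f -/g in cf cg l1 l2; have fyz : f y = f z by exact: yz.
  rewrite fyz in cf l1.
  (* Weighting the two bounds on f + g by 1 - s and s and subtracting the convexity bound on g m
     gives f m >= f z - 4 delta s (1 - s) D. *)
  have w1 := ler_wpM2l (_ : 0 <= 1 - s) l1; have w2 := ler_wpM2l s0 l2.
  have {}w1 := w1 ltac:(lra).
  have p0 : 0 <= delta * (s * D) by exact: mulr_ge0.
  have p1 : 0 <= s * (delta * (s * D)) by exact: mulr_ge0.
  by rewrite ger0_norm; lra.
rewrite sumr_const card_ord -mulr_natl; lra.
Qed.

(** At time s the segment point is at distance (1 - s) d(z, y) from y and is corrected by at most
    5/4 * (s / 5) d(z, y), a quarter of what was gained. The bounds rho / 4 keep point and
    correction in the chart. At both ends the defect is 0, so [Phi] fixes z and y. *)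
Lemma fiber_ball_contractible (A : set X) x r delta k (P : 'I_k -> bool -> X) rho
    (V : set X) y e :
  convex_ball A -> compact A -> cball x (4 * r) `<=` A -> 0 <= delta ->
  20 * k%:R * delta <= 1 ->
  strainer_chart A x r delta P rho -> (forall z, d x z < rho -> V z) ->
  d x y < rho / 4 -> 0 < e -> e < rho / 4 ->
  contractible R [set z | [/\ V z,
    (forall i, d (P i false) z = d (P i false) y) & ball y e z]].
Proof.
move=> convA compA rA delta0 dk chart VV xy e0 er.
have rho0 := sc_gt0 chart; have rr := sc_le chart.
have inA u : d x u < rho -> A u by move=> xu; apply: rA; rewrite /cball/=; lra.
have Ay : A y by apply: inA; lra.
pose omega i := d (P i false) y.
pose Phi := retraction A P omega.
set F := [set z | _].
pose H (sz : R * X) := Phi (pt A sz.2 y (sz.1 * d sz.2 y)).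
have Fy : F y by split => //; [apply: VV; lra|exact: ballxx].
have FD z : F z -> d z y < e by move=> [_ _]; rewrite ballEmdist/= metric_sym.
have Fx z : F z -> d x z < rho.
  move=> /FD ze; have := metric_triangle x y z; rewrite (metric_sym y z); lra.
have main s z : s \in `[0, 1] -> F z -> let m := pt A z y (s * d z y) in
    [/\ basin x P rho omega m, 5 * defect P omega m <= s * d z y,
        d x m + 5 / 4 * defect P omega m < rho & d m y = (1 - s) * d z y].
  rewrite in_itv/= => /andP[s0 s1] Fz; set m := pt A z y (s * d z y).
  have ze := FD _ Fz; have xz := Fx _ Fz; have D0 := mdist_ge0 z y.
  have sD0 : 0 <= s * d z y by exact: mulr_ge0.
  have sDD : s * d z y <= d z y by exact: ler_piMl.
  have my : d m y = (1 - s) * d z y.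
    by rewrite /m pt_distr//; [ring|exact: inA].
  have xm : d x m <= d x y + d z y.
    apply: le_trans (metric_triangle _ y _) _; rewrite (metric_sym y m) my; lra.
  have df : 5 * defect P omega m <= s * d z y.
    have := @defect_on_segment A x r delta k P rho z y s convA compA rA delta0 chart xz.
    rewrite -/m => dm; have {}dm := dm ltac:(lra) ltac:(lra) s0 s1.
    have {}dm : defect P omega m <= 4 * k%:R * delta * (s * d z y).
      by apply: dm => i; case: Fz => _ + _; exact.
    have : 20 * k%:R * delta * (s * d z y) <= s * d z y by exact: ler_piMl.
    by lra.
  have bm : d x m + 5 / 4 * defect P omega m < rho by lra.
  by [].
exists y => //; exists H; split.
- apply: continuous_in_subspaceT => -[s z]; rewrite inE => -[/= sI Fz].
  have [mb _ _ _] := main s z sI Fz.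
  have cpt : pt A u.2 y (u.1 * d u.2 y) @[u --> (s, z)] --> pt A z y (s * d z y).
    have c2 : u.2 @[u --> (s, z)] --> z by exact: cvg_snd.
    have c1 : u.1 @[u --> (s, z)] --> s by exact: cvg_fst.
    apply: cvg_pt => //.
    + exact: inA (Fx _ Fz).
    + apply: c2; apply/near_dist; exists (rho - d x z).
        by rewrite subr_gt0; exact: Fx.
      by move=> v zv; apply: inA; have := metric_triangle x z v; lra.
    + exact: nearW.
    + exact: cvg_cst.
    + by apply: cvgM => //; apply: cvg_mdist => //; exact: cvg_cst.
  apply: cvg_comp cpt _.
  exact: (retraction_continuous convA compA rA delta0 dk chart).
- move=> s z sI Fz; have [mb df xm my] := main s z sI Fz.
  rewrite /H/=; set m := pt A z y _ in mb df xm my *.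
  have dm := retraction_dist convA compA rA delta0 dk chart mb.
  have Dz := FD _ Fz; have D0 := mdist_ge0 z y.
  move: sI; rewrite in_itv/= => /andP[s0 s1].
  have sD0 : 0 <= s * d z y by exact: mulr_ge0.
  split.
  + by apply: VV; apply: le_lt_trans (metric_triangle _ m _) _; rewrite /Phi; lra.
  + by move=> i; exact: (retraction_fiber convA compA rA delta0 dk chart).
  + rewrite ballEmdist/=; apply: le_lt_trans (metric_triangle _ m _) _.
    by rewrite metric_sym my /Phi; lra.
- move=> z Fz; have [|mb df _ _] := main 0 z _ Fz; first by rewrite in_itv/= lexx ler01.
  have dm := retraction_dist convA compA rA delta0 dk chart mb.
  have zA : A z by exact: inA (Fx _ Fz).
  have z0 : pt A z y (0 * d z y) = z by rewrite mul0r pt0.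
  rewrite /H/= z0; rewrite z0 mul0r in df dm.
  apply/esym/mdist_positivity/eqP; rewrite eq_le mdist_ge0 andbT.
  by apply: le_trans dm _; lra.
- move=> z Fz; have [|mb df _ _] := main 1 z _ Fz; first by rewrite in_itv/= lexx ler01.
  have dm := retraction_dist convA compA rA delta0 dk chart mb.
  have zA : A z by exact: inA (Fx _ Fz).
  have z1 : pt A z y (1 * d z y) = y by rewrite mul1r pt1.
  rewrite /H/= z1; rewrite z1 in dm.
  have f0 : defect P omega y = 0.
    by rewrite /defect big1// => i _; rewrite subrr normr0.
  apply/esym/mdist_positivity/eqP; rewrite eq_le mdist_ge0 andbT.
  by apply: le_trans dm _; rewrite f0 mulr0.
Qed.

End StrainerMap.

Theorem theorem1p11 (R : realType) (X : metricType R) (kappa : R)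
    (x0 : X) (r0 : R) (k : nat) (delta : R) (p : 'I_k -> X) (V : set X) :
  GCBA X -> curvature_le kappa X -> tiny_ball kappa x0 r0 ->
  (1 <= k)%N -> 0 < delta -> delta <= 1 / (20 * k%:R) ->
  open V -> V `<=` ball x0 r0 ->
  strainer_map x0 r0 delta p V ->
  open_map_on V (dist_map p) /\
  (forall V' : set X, compact V' -> V' `<=` V ->
     exists2 eps : R, 0 < eps &
       forall (x : X) (r : R), V' x -> 0 < r -> r < eps ->
         contractible R
           [set y | [/\ V y, dist_map p y = dist_map p x & ball x r y]]).
Proof.
move=> [_ _ lgc _] _ tiny k1 delta0 deltak oV VU [pU str].
(* Points of V are within r0 of x0 and strainer points within 5 r0, so closed balls around points of
   V reaching the strainer points have radius at most 6 r0 and stay in [A]. *)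
pose A : set X := cball x0 (10 * r0).
have convA : convex_ball A := tiny_ball_convex tiny.
have [r0_gt0 _ _ compA _] := tiny.
have dk : 20 * k%:R * delta <= 1.
  by rewrite mulrC -ler_pdivlMr// mulr_gt0// ltr0n.
have ballA x : V x -> cball x (4 * r0) `<=` A.
  move=> /VU; rewrite ballEmdist /A /cball/= => x0x y xy.
  by have := metric_triangle x0 x y; rewrite /= in xy *; lra.
have chart x (O : set X) : V x -> nbhs x O -> exists P rho,
    [/\ strainer_chart A x r0 delta P rho, forall i, P i false = p i &
        forall y, mdist x y < rho -> O y].
  move=> Vx /near_dist[e e0 eO]; have [px sph] := str x Vx.
  have [|P [rho [ch Pp]]] :=
    strainer_chart_exists convA compA lgc r0_gt0 (ballA x Vx) delta0 _ sph.
    move=> i; apply: (geod_ray_to convA r0_gt0 (ballA x Vx)).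
      by apply/eqP; exact: (px i).2.
    have := VU _ Vx; rewrite ballEmdist /A /cball/= => x0x y xy.
    have := pU i; rewrite /cball/= => pi5.
    have := metric_triangle x x0 (p i); rewrite (metric_sym x x0).
    by have := metric_triangle x0 x y; rewrite /= in xy *; lra.
  have rho0 := sc_gt0 ch.
  exists P, (Num.min rho e); split => //.
    apply: strainer_chart_shrink ch _ _; first by rewrite lt_min rho0.
    by rewrite ge_min lexx.
  by move=> y; rewrite lt_min => /andP[_]; exact: eO.
have mapP x y : dist_map p x = dist_map p y <-> forall i, mdist (p i) x = mdist (p i) y.
  split=> [/rowP h i|h]; first by have := h i; rewrite !mxE.
  by apply/rowP => i; rewrite !mxE.
split.
  move=> O oO; rewrite openE => _ [x [Vx Ox] <-].
  have VOx : nbhs x (V `&` O) by apply: filterI; exact: open_nbhs_nbhs.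
  have [P [rho [ch Pp VO]]] := chart x _ Vx VOx.
  have rho0 := sc_gt0 ch.
  have k0 : 0 < k%:R :> R by rewrite ltr0n.
  (* Balls of row vectors are taken coordinatewise; dividing by k bounds the sum of the k coordinate
     errors by rho / 2, and 5/4 * rho / 2 < rho. *)
  apply/nbhs_ballP; exists (rho / (2 * k%:R)); first by rewrite /= divr_gt0// mulr_gt0.
  move=> w [_ xw]; pose omega i := w 0 i.
  have df : defect P omega x <= rho / 2.
    have -> : rho / 2 = \sum_(i < k) (rho / (2 * k%:R)).
      by rewrite sumr_const card_ord -mulr_natl; field; rewrite gt_eqF.
    apply: ler_sum => i _; have := xw 0 i; rewrite /ball/= /ball_ mxE /= Pp distrC.
    exact: ltW.
  have xb : basin x P rho omega x by rewrite /basin/= mdistxx add0r; lra.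
  have dx := retraction_dist convA compA (ballA x Vx) (ltW delta0) dk ch xb.
  exists (retraction A P omega x); first by apply: VO; lra.
  apply/rowP => i; rewrite mxE -Pp.
  exact: (retraction_fiber convA compA (ballA x Vx) (ltW delta0) dk ch).
move=> V' cV' V'V.
pose good eps x := forall r, 0 < r -> r < eps ->
  contractible R [set y | [/\ V y, dist_map p y = dist_map p x & ball x r y]].
(* The chart at x serves every center within rho / 4 of x, so admissible radii are locally uniform
   and compactness of V' makes them uniform. *)
have : \forall eps \near (0 : R)^'+, V' `<=` good eps.
  move/compact_near_coveringP : cV'; apply => x V'x; have Vx := V'V _ V'x.
  have [P [rho [ch Pp VV]]] := chart x V Vx (open_nbhs_nbhs (conj oV Vx)).
  have rho4 : 0 < rho / 4 by rewrite divr_gt0// (sc_gt0 ch).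
  exists ([set y | mdist x y < rho / 4], [set eps | eps < rho / 4]).
    split; first by apply/near_dist; exists (rho / 4).
    exact: nbhs_right_lt.
  move=> [y eps] /= [xy erho] r rp reps.
  have := fiber_ball_contractible convA compA (ballA x Vx) (ltW delta0) dk ch VV xy rp
    (lt_trans reps erho).
  congr (contractible R _); apply/seteqP; split => z [Vz zy yz]; split => //.
    by apply/mapP => i; rewrite -Pp.
  by move=> i; rewrite Pp; move: i; exact/mapP.
(* The property is known for values strictly below e, hence the half. *)
move=> /near_rightP[e e0 H]; exists (e / 2); first by rewrite divr_gt0.
move=> x r V'x r_gt0 re; apply: (H (e / 2)) => //; first by rewrite divr_gt0.
by rewrite ltr_pdivrMr// ltr_pMr// ltr1n.
Qed.
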